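(* Let $T=T(F)$ be the tensor algebra and $\mathbb S^{nc}(F)$ the noncommutative symmetric algebra of the simple two-sided vector space ${}_{K_0}F_{K_1}$ of rank 2, and let $\mathcal T$ be the $\mathbb Z$-indexed algebra with $\mathcal T_{ij}=\bigoplus_{s\in G_{ij}}F_s$ for $j>i+1$ described in the context. There is an isomorphism of $\mathbb Z$-indexed algebras $T(F)\xrightarrow{\sim}\mathcal T$. Moreover, for all $i,j\in\mathbb Z$ with $i\le j$ there are $K_i$-$K_j$-bilinear isomorphisms \[\mathbb S^{nc}(F)_{ij}\cong\begin{cases}K_i\oplus F_{\tau_{i,i+2}}\oplus F_{\tau_{i,i+4}}\oplus\cdots\oplus F_{\tau_{ij}} & \text{if } j-i \text{ is even},\\ {}_{K_i}F_{K_{i+1}}\oplus F_{\tau_{i,i+3}}\oplus F_{\tau_{i,i+5}}\oplus\cdots\oplus F_{\tau_{ij}} & \text{if } j-i\text{ is odd}\end{cases}\] (for $j=i$ the right-hand side is $K_i$, and for $j=i+1$ it is ${}_{K_i}F_{K_{i+1}}$).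
   Context: All fields have characteristic $\ne 2$. $F$ is a field and $K_0,K_1\subset F$ are subfields of index 2 such that the $K_0$-$K_1$-bimodule $F$ is simple. Integer subscripts on fields and groups are read modulo 2, so $K_i=K_{i\bmod 2}$. $G_i=\mathrm{Gal}(F/K_i)=\{1,\tau_i\}$. A $\mathbb Z$-indexed algebra $C$ consists of abelian groups $C_{ij}$ ($i,j\in\mathbb Z$) with associative biadditive multiplications $C_{ij}\times C_{jl}\to C_{il}$ and local units $e_i\in C_{ii}$; it is identified with the ring $\bigoplus_{i,j}C_{ij}$, where the product of $C_{ij}$ and $C_{rl}$ is $0$ for $j\neq r$. An isomorphism of $\mathbb Z$-indexed algebras is a family of additive isomorphisms of the $(i,j)$ components compatible with multiplication and units. Tensor algebra $T=T(F)$: $T_{ij}=0$ for $i>j$, $T_{ii}=K_i$, and for $i<j$, $T_{ij}=F\otimes_{K_{i+1}}F\otimes_{K_{i+2}}\cdots\otimes_{K_{j-1}}F$ ($j-i$ factors), a $K_i$-$K_j$-bimodule, with multiplication given by the tensor product over $K_j$. (In general $T(V)$ is built from iterated duals $V^{i*}$; here each $F^{i*}$ is identified with the $K_i$-$K_{i+1}$-bimodule $F$ through the reduced traces $a\mapsto\frac12(a+\tau_i(a))$.) Noncommutative symmetric algebra: $\mathbb S^{nc}(F)=T/R$, where $R$ is the two-sided ideal generated by the elements $h_i=1\otimes_{K_{i+1}}1+w_{i+1}^{-1}\otimes_{K_{i+1}}w_{i+1}\in T_{i,i+2}$ $(i\in\mathbb Z)$, with $w_{i+1}\in F\setminus K_{i+1}$,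 $w_{i+1}^2\in K_{i+1}$ (equivalently $0\neq w_{i+1}$ and $\tau_{i+1}(w_{i+1})=-w_{i+1}$). (The $K_i$-span of $h_i$ is the image $Q_i$ of the unit $K_i\hookrightarrow F^{i*}\otimes F^{(i+1)*}$ of the adjunction between tensoring with $F^{i*}$ and $F^{(i+1)*}$.) For $j>i+1$ set $G_{ij}=G_{i+1}\times G_{i+2}\times\cdots\times G_{j-1}$; for $s=(s_{i+1},\dots,s_{j-1})\in G_{ij}$ put $\overline s=s_{i+1}\circ s_{i+2}\circ\cdots\circ s_{j-1}\in\mathrm{Aut}(F)$, and let $F_s$ be the $K_i$-$K_j$-bimodule with underlying group $F$ and actions $a.x.b=a\,x\,\overline s(b)$. Let $\tau_{ij}=(\tau_{i+1},\tau_{i+2},\dots,\tau_{j-1})\in G_{ij}$. The $\mathbb Z$-indexed algebra $\mathcal T$: $\mathcal T_{ij}=0$ for $j<i$, $\mathcal T_{ii}=K_i$, $\mathcal T_{i,i+1}={}_{K_i}F_{K_{i+1}}$ (viewed as $F_s$ for $s$ the empty tuple, $\overline s=1$), and $\mathcal T_{ij}=\bigoplus_{s\in G_{ij}}F_s$ for $j>i+1$. Multiplication $\ast$: products with $\mathcal T_{ii}=K_i$ are the bimodule actions; for $i<j<l$, $a\in F_s\subset\mathcal T_{ij}$, $b\in F_{s'}\subset\mathcal T_{jl}$, $a\ast b=a\,\overline s(b)\oplus a\,\overline s\tau_j(b)\in F_{(s,1,s')}\oplus F_{(s,\tau_j,s')}\subset\mathcal T_{il}$; products of $\mathcal T_{ij}$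 and $\mathcal T_{rl}$ with $j\ne r$ are $0$. *)

(* Defs.v *)
From HB Require Import structures.
From mathcomp Require Import all_boot all_order all_algebra.
From mathcomp Require Import zify ring.
From mathcomp Require Import boolp freeg.

Set Implicit Arguments.
Unset Strict Implicit.
Unset Printing Implicit Defensive.

Import GRing.Theory.
Local Open Scope ring_scope.
Local Open Scope quotient_scope.

Section Subgroups.
Variable V : zmodType.

Inductive in_subgroup (X : V -> Prop) : V -> Prop :=
| sg_gen x : X x -> in_subgroup X x
| sg_0 : in_subgroup X 0
| sg_B x y : in_subgroup X x -> in_subgroup X y -> in_subgroup X (x - y).

Definition subgroup_gen (X : V -> Prop) : {pred V} := fun x => `[< in_subgroup X x >].

Lemma subgroup_gen_closed X : zmod_closed (subgroup_gen X).
Proof.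
split; first by apply/asboolP; apply: sg_0.
by move=> x y /asboolP hx /asboolP hy; apply/asboolP; apply: sg_B.
Qed.

HB.instance Definition _ X :=
  GRing.isZmodClosed.Build V (subgroup_gen X) (subgroup_gen_closed X).

End Subgroups.

Section Quotients.
Variables (V : zmodType) (I : zmodClosed V).
Local Notation QV := (Quotient.quot I).

Lemma piB x y : \pi_QV (x - y) = \pi_QV x - \pi_QV y.
Proof. exact: raddfB. Qed.

Lemma piD x y : \pi_QV (x + y) = \pi_QV x + \pi_QV y.
Proof. exact: raddfD. Qed.

Lemma pi_eqP x y : x - y \in I -> \pi_QV x = \pi_QV y.
Proof. by rewrite Quotient.idealrBE => /eqP. Qed.

Lemma pi_eq0 x : x \in I -> \pi_QV x = 0.
Proof. by move=> Ix; rewrite (@pi_eqP x 0) ?subr0 // raddf0. Qed.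

Lemma repr_pi x : repr (\pi_QV x) - x \in I.
Proof. by rewrite Quotient.idealrBE reprK. Qed.

End Quotients.

Record zalg := ZAlg {
  zcomp :> int -> int -> zmodType;
  zmul : forall i j l, zcomp i j -> zcomp j l -> zcomp i l;
  zone : forall i, zcomp i i;
  zmulDl : forall i j l (x x' : zcomp i j) (y : zcomp j l),
    zmul (x + x') y = zmul x y + zmul x' y;
  zmulDr : forall i j l (x : zcomp i j) (y y' : zcomp j l),
    zmul x (y + y') = zmul x y + zmul x y';
  zmulA : forall i j l m (x : zcomp i j) (y : zcomp j l) (z : zcomp l m),
    zmul x (zmul y z) = zmul (zmul x y) z;
  zmul1l : forall i j (x : zcomp i j), zmul (zone i) x = x;
  zmul1r : forall i j (x : zcomp i j), zmul x (zone j) = x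
}.

Definition zalg_iso (A B : zalg) : Prop :=
  exists f : forall i j, {additive A i j -> B i j},
  [/\ forall i j, bijective (f i j),
      forall i j l (x : A i j) (y : A j l),
        f i l (zmul x y) = zmul (f i j x) (f j l y)
    & forall i, f i i (zone A i) = zone B i].

Section ZQuotient.
Variables (A : zalg) (X : forall i j, A i j -> Prop).

Inductive in_ideal : forall i j, A i j -> Prop :=
| id_gen i j (x : A i j) : X x -> in_ideal x
| id_0 i j : in_ideal (0 : A i j)
| id_B i j (x y : A i j) : in_ideal x -> in_ideal y -> in_ideal (x - y)
| id_Ml i j l (a : A i j) (x : A j l) : in_ideal x -> in_ideal (zmul a x)
| id_Mr i j l (x : A i j) (a : A j l) : in_ideal x -> in_ideal (zmul x a).

Definition zideal i j : {pred A i j} := fun x => `[< in_ideal x >].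

Lemma zideal_closed i j : zmod_closed (@zideal i j).
Proof.
split; first by apply/asboolP; apply: id_0.
by move=> x y /asboolP hx /asboolP hy; apply/asboolP; apply: id_B.
Qed.

HB.instance Definition _ i j :=
  GRing.isZmodClosed.Build (A i j) (@zideal i j) (zideal_closed i j).

Definition zquot_comp i j : zmodType := Quotient.quot (@zideal i j).

Definition zquot_pi i j (x : A i j) : zquot_comp i j :=
  \pi_(Quotient.quot (@zideal i j)) x.

Definition zquot_mul i j l (x : zquot_comp i j) (y : zquot_comp j l) :
  zquot_comp i l := zquot_pi (zmul (repr x) (repr y)).

Lemma zquot_piD i j (x y : A i j) : zquot_pi (x + y) = zquot_pi x + zquot_pi y.
Proof. exact: piD. Qed.

Lemma zquot_piK i j (x : zquot_comp i j) : exists x', x = zquot_pi x'.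
Proof. by exists (repr x); rewrite /zquot_pi reprK. Qed.

Lemma zquot_mulE i j l (x : A i j) (y : A j l) :
  zquot_mul (zquot_pi x) (zquot_pi y) = zquot_pi (zmul x y).
Proof.
have addBl (u v : A i j) (z : A j l) : zmul (u - v) z = zmul u z - zmul v z.
  by apply/(addIr (zmul v z)); rewrite -zmulDl !subrK.
have addBr (z : A i j) (u v : A j l) : zmul z (u - v) = zmul z u - zmul z v.
  by apply/(addIr (zmul z v)); rewrite -zmulDr !subrK.
have hr i' j' (u : A i' j') : in_ideal (repr (zquot_pi u) - u).
  by have /asboolP := repr_pi (@zideal i' j') u.
apply: pi_eqP.
rewrite -[X in X - _](subrK (zmul x (repr (zquot_pi y)))) -addrA.
rewrite -addBl -addBr; apply: rpredD; apply/asboolP.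
  exact/id_Mr/hr.
exact/id_Ml/hr.
Qed.

Lemma zquot_mulDl i j l (x x' : zquot_comp i j) (y : zquot_comp j l) :
  zquot_mul (x + x') y = zquot_mul x y + zquot_mul x' y.
Proof.
case: (zquot_piK x) (zquot_piK x') (zquot_piK y) => u -> [] v -> [] z ->.
by rewrite -zquot_piD !zquot_mulE zmulDl zquot_piD.
Qed.

Lemma zquot_mulDr i j l (x : zquot_comp i j) (y y' : zquot_comp j l) :
  zquot_mul x (y + y') = zquot_mul x y + zquot_mul x y'.
Proof.
case: (zquot_piK x) (zquot_piK y) (zquot_piK y') => u -> [] v -> [] z ->.
by rewrite -zquot_piD !zquot_mulE zmulDr zquot_piD.
Qed.

Lemma zquot_mulA i j l m (x : zquot_comp i j) (y : zquot_comp j l)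
  (z : zquot_comp l m) :
  zquot_mul x (zquot_mul y z) = zquot_mul (zquot_mul x y) z.
Proof.
case: (zquot_piK x) (zquot_piK y) (zquot_piK z) => u -> [] v -> [] t ->.
by rewrite !zquot_mulE zmulA.
Qed.

Lemma zquot_mul1l i j (x : zquot_comp i j) :
  zquot_mul (zquot_pi (zone A i)) x = x.
Proof. by case: (zquot_piK x) => u ->; rewrite zquot_mulE zmul1l. Qed.

Lemma zquot_mul1r i j (x : zquot_comp i j) :
  zquot_mul x (zquot_pi (zone A j)) = x.
Proof. by case: (zquot_piK x) => u ->; rewrite zquot_mulE zmul1r. Qed.

Definition zquot : zalg :=
  ZAlg zquot_mulDl zquot_mulDr zquot_mulA zquot_mul1l zquot_mul1r.

End ZQuotient.

Section Subfield.
Variables (F : fieldType) (K : divringClosed F).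

Record subfield := Subfield { sfval :> F; sfvalP : sfval \in K }.
HB.instance Definition _ := [isSub for sfval].
HB.instance Definition _ := [Choice of subfield by <:].
HB.instance Definition _ := [SubChoice_isSubIntegralDomain of subfield by <:].
HB.instance Definition _ := [SubIntegralDomain_isSubField of subfield by <:].

(* the element x of K; junk value 0 when x is not in K *)
Definition to_sf (x : F) : subfield := insubd (0 : subfield) x.

Lemma to_sfK x : x \in K -> to_sf x = x :> F.
Proof. by move=> Kx; rewrite /to_sf; exact: insubdK. Qed.

Definition degree2 : Prop :=
  exists e : 'I_2 -> F, forall x : F,
    exists! c : {ffun 'I_2 -> subfield}, x = \sum_r (c r : F) * e r.

(* t is the non-identity element of Gal(F/K) *)
Definition gal_generator (t : {rmorphism F -> F}) : Prop :=
  [/\ bijective t, forall x, x \in K -> t x = x & exists x, t x <> x].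

End Subfield.

Definition simple_bimodule (F : fieldType) (K L : divringClosed F) : Prop :=
  forall P : F -> Prop,
    P 0 -> (forall x y, P x -> P y -> P (x - y)) ->
    (forall a x b, a \in K -> b \in L -> P x -> P (a * x * b)) ->
    (forall x, P x -> x = 0) \/ (forall x, P x).

(* A Z-indexed algebra with A_ii = K_i and A_ij = 0 for j < i is given by the
   groups up i n = A_{i,i+n+1}, with actions of the fields and products.  The
   indices of the arguments and of the result are independent parameters of
   these operations, which are meaningful (and constrained) only when the
   indices match: this avoids transports along equalities of integers. *)

Section Upper.
Variables (F : fieldType) (K : int -> divringClosed F).

Record upper := Upper {
  up :> int -> nat -> zmodType;
  (* for j = i and p = n *)
  upl : forall i j n p, F -> up j n -> up i p;
  (* for p = n *)
  upr : forall i n p, up i n -> F -> up i p;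
  (* for j = i + m + 1 and p = m + n + 1 *)
  upm : forall i j m n p, up i m -> up j n -> up i p;
  upl1 : forall i n (x : up i n), upl i n 1 x = x;
  uplA : forall i n a b (x : up i n),
    upl i n a (upl i n b x) = upl i n (a * b) x;
  uplDl : forall i n a b (x : up i n),
    upl i n (a + b) x = upl i n a x + upl i n b x;
  uplDr : forall i n a (x y : up i n),
    upl i n a (x + y) = upl i n a x + upl i n a y;
  upr1 : forall i n (x : up i n), upr n x 1 = x;
  uprA : forall i n a b (x : up i n), upr n (upr n x a) b = upr n x (a * b);
  uprDl : forall i n a (x y : up i n),
    upr n (x + y) a = upr n x a + upr n y a;
  uprDr : forall i n a b (x : up i n),
    upr n x (a + b) = upr n x a + upr n x b;
  upA : forall i n a b (x : up i n),
    upl i n a (upr n x b) = upr n (upl i n a x) b;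
  upmDl : forall i j m n p, j = i + m.+1%:Z -> p = (m + n).+1 ->
    forall (x x' : up i m) (y : up j n),
    upm p (x + x') y = upm p x y + upm p x' y;
  upmDr : forall i j m n p, j = i + m.+1%:Z -> p = (m + n).+1 ->
    forall (x : up i m) (y y' : up j n),
    upm p x (y + y') = upm p x y + upm p x y';
  upml : forall i j m n p, j = i + m.+1%:Z -> p = (m + n).+1 ->
    forall a (x : up i m) (y : up j n),
    upl i p a (upm p x y) = upm p (upl i m a x) y;
  upmr : forall i j m n p, j = i + m.+1%:Z -> p = (m + n).+1 ->
    forall a (x : up i m) (y : up j n),
    upr p (upm p x y) a = upm p x (upr n y a);
  upmC : forall i j m n p, j = i + m.+1%:Z -> p = (m + n).+1 ->
    forall a (x : up i m) (y : up j n), a \in K j ->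
    upm p (upr m x a) y = upm p x (upl j n a y);
  upmA : forall i j l m n q p p' r, j = i + m.+1%:Z -> l = j + n.+1%:Z ->
    p = (n + q).+1 -> p' = (m + n).+1 -> r = (m + p).+1 ->
    forall (x : up i m) (y : up j n) (z : up l q),
    upm r x (upm p y z) = upm r (upm p' x y) z
}.

Variable U : upper.

(* the component A_{i,i+d} *)
Definition comp (i d : int) : zmodType :=
  match d with
  | Posz 0 => subfield (K i)
  | Posz n.+1 => U i n
  | Negz _ => 'I_1
  end.

(* the product A_{i,i+d} x A_{j,j+d'} -> A_{i,i+e}, for j = i+d, e = d+d' *)
Definition comp_mul i j d d' e : comp i d -> comp j d' -> comp i e :=
  match d as d0, d' as d1, e as e0
  return comp i d0 -> comp j d1 -> comp i e0 with
  | Posz 0, Posz 0, Posz 0 => fun a b => to_sf (K i) ((a : F) * (b : F))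
  | Posz 0, Posz n.+1, Posz p.+1 => fun a y => @upl U i j n p a y
  | Posz m.+1, Posz 0, Posz p.+1 => fun x b => @upr U i m p x b
  | Posz m.+1, Posz n.+1, Posz p.+1 => fun x y => @upm U i j m n p x y
  | _, _, _ => fun _ _ => 0
  end.

(* the element a of A_ii = K_i, for d = 0 *)
Definition comp_scal i d (a : subfield (K i)) : comp i d :=
  match d with Posz 0 => a | _ => 0 end.

Lemma comp_mulDl i j d d' e : j = i + d -> e = d + d' ->
  forall (x x' : comp i d) (y : comp j d'),
  comp_mul e (x + x') y = comp_mul e x y + comp_mul e x' y.
Proof.
case: d => [[|m]|m]; case: d' => [[|n]|n]; case: e => [[|p]|p] //=;
  move=> hj he x x' y; try by rewrite addr0.
- have hij : j = i by lia.
  clear hj; subst j; apply/val_inj.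
  by rewrite /= !to_sfK ?mulrDl ?rpredD ?rpredM ?rpredD ?sfvalP.
- have [hij hn] : j = i /\ n = p by lia.
  by clear hj he; subst j p; apply: uplDl.
- have hm : m = p by lia.
  by clear hj he; subst p; apply: uprDl.
- by apply: upmDl; lia.
Qed.

Lemma comp_mulDr i j d d' e : j = i + d -> e = d + d' ->
  forall (x : comp i d) (y y' : comp j d'),
  comp_mul e x (y + y') = comp_mul e x y + comp_mul e x y'.
Proof.
case: d => [[|m]|m]; case: d' => [[|n]|n]; case: e => [[|p]|p] //=;
  move=> hj he x y y'; try by rewrite addr0.
- have hij : j = i by lia.
  clear hj; subst j; apply/val_inj.
  by rewrite /= !to_sfK ?mulrDr ?rpredD ?rpredM ?rpredD ?sfvalP.
- have [hij hn] : j = i /\ n = p by lia.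
  by clear hj he; subst j p; apply: uplDr.
- have hm : m = p by lia.
  by clear hj he; subst p; apply: uprDr.
- by apply: upmDr; lia.
Qed.

Lemma comp_mul0l i j d d' e : j = i + d -> e = d + d' ->
  forall y : comp j d', comp_mul e (0 : comp i d) y = 0.
Proof.
move=> hj he y; apply: (addrI (comp_mul e (0 : comp i d) y)).
by rewrite -comp_mulDl // !addr0.
Qed.

Lemma comp_mul0r i j d d' e : j = i + d -> e = d + d' ->
  forall x : comp i d, comp_mul e x (0 : comp j d') = 0.
Proof.
move=> hj he x; apply: (addrI (comp_mul e x (0 : comp j d'))).
by rewrite -comp_mulDr // !addr0.
Qed.

Lemma comp_mulA i j l d d' d'' e e' r : j = i + d -> l = j + d' ->
  e = d' + d'' -> e' = d + d' -> r = d + e ->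
  forall (x : comp i d) (y : comp j d') (z : comp l d''),
  comp_mul r x (comp_mul e y z) = comp_mul r (comp_mul e' x y) z.
Proof.
move=> hj hl he he' hr.
case: d hj he' hr => [m|m] hj he' hr x y z; last first.
  by rewrite [x]ord1 !comp_mul0l //; lia.
case: d' hl he he' y => [n|n] hl he he' y; last first.
  by rewrite [y]ord1 comp_mul0l ?comp_mul0r ?comp_mul0l //; lia.
case: d'' he z => [q|q] he z; last first.
  by rewrite [z]ord1 !comp_mul0r //; lia.
have {}he : e = Posz (n + q) by lia.
have {}he' : e' = Posz (m + n) by lia.
have {}hr : r = Posz (m + (n + q)) by lia.
subst e e' r.
have Kij : (m = 0)%N -> K j = K i by move=> m0; congr K; lia.
have Kjl : (n = 0)%N -> K l = K j by move=> n0; congr K; lia.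
case: m Kij hj x => [|m] Kij hj x; case: n Kjl hl y => [|n] Kjl hl y;
  case: q z => [|q] z; rewrite ?add0n ?addn0 ?addSn ?addnS /=.
- have [hij hjl] : j = i /\ l = i by lia.
  clear Kij Kjl hj hl; subst j l.
  by apply/val_inj; rewrite /= !to_sfK ?mulrA ?rpredM ?sfvalP.
- have [hij hjl] : j = i /\ l = i by lia.
  clear Kij Kjl hj hl; subst j l.
  by rewrite uplA to_sfK ?rpredM ?sfvalP.
- have hij : j = i by lia.
  by clear hj Kij; subst j; rewrite upA.
- have hij : j = i by lia.
  by clear hj Kij; subst j; rewrite upml.
- by rewrite to_sfK ?uprA // rpredM ?sfvalP // -Kjl ?sfvalP.
- have hjl : l = j by lia.
  by clear hl Kjl; subst l; rewrite upmC ?sfvalP.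
- by rewrite upmr.
- by apply: upmA; lia.
Qed.

Lemma comp_mul1l i d0 d (x : comp i d) : d0 = 0 ->
  comp_mul d (comp_scal d0 (1 : subfield (K i))) x = x.
Proof.
move=> ->; case: d x => [[|n]|n] //= x; last by rewrite [x]ord1.
  by apply/val_inj; rewrite /= to_sfK mul1r // sfvalP.
exact: upl1.
Qed.

Lemma comp_mul1r i j d0 d (x : comp i d) : d0 = 0 -> j = i + d ->
  comp_mul d x (comp_scal d0 (1 : subfield (K j))) = x.
Proof.
move=> ->; case: d x => [[|n]|n] //= x hj; last by rewrite [x]ord1.
  by apply/val_inj; rewrite /= to_sfK mulr1 // sfvalP.
exact: upr1.
Qed.

Definition upper_comp i j : zmodType := comp i (j - i).

Definition upper_mul i j l (x : upper_comp i j) (y : upper_comp j l) :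
  upper_comp i l := comp_mul (l - i) x y.

Definition upper_scal i (a : subfield (K i)) : upper_comp i i :=
  comp_scal (i - i) a.

Program Definition upper_zalg : zalg :=
  @ZAlg upper_comp upper_mul (fun i => upper_scal (1 : subfield (K i)))
    _ _ _ _ _.
Next Obligation. by apply: comp_mulDl; lia. Qed.
Next Obligation. by apply: comp_mulDr; lia. Qed.
Next Obligation. by apply: comp_mulA; lia. Qed.
Next Obligation. by apply: comp_mul1l; lia. Qed.
Next Obligation. by apply: comp_mul1r; lia. Qed.

End Upper.

Section FreeGroup.
Variable T : choiceType.
Implicit Types x y : {freeg T / int}.

Lemma fgliftB (M : lmodType int) (f : T -> M) x y :
  fglift f (x - y) = fglift f x - fglift f y.
Proof. exact: lift_is_additive. Qed.

Lemma fglift1 (M : lmodType int) (f : T -> M) w :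
  fglift f (<< w >> : {freeg T / int}) = f w.
Proof. by rewrite liftU scale1r. Qed.

Lemma freeg_ind (P : {freeg T / int} -> Prop) :
  P 0 -> (forall x y, P x -> P y -> P (x - y)) -> (forall w, P << w >>) ->
  forall x, P x.
Proof.
move=> P0 PB P1 x.
have PN y : P y -> P (- y) by move=> Py; rewrite -sub0r; apply: PB.
have PD y z : P y -> P z -> P (y + z).
  by move=> Py Pz; rewrite -[z]opprK; apply: PB => //; apply: PN.
rewrite -(freeg_sumE x); apply: big_ind => // w _.
have Pn (n : nat) : P (<< n%:Z *g w >>).
  elim: n => [|n IHn]; first by rewrite freegU0.
  by rewrite -addn1 PoszD -freegUD; apply: PD.
case: (coeff w x) => n //.
by rewrite NegzE -freegUN; apply: PN.
Qed.

End FreeGroup.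

Section Tensor.
Variables (F : fieldType) (K : int -> divringClosed F).

Definition tuple_of (n : nat) (s : seq F) : n.-tuple F :=
  [tuple nth 0 s r | r < n].

Lemma tuple_ofK n (s : seq F) : size s = n -> tuple_of n s = s :> seq F.
Proof.
move=> hs; apply: (@eq_from_nth _ 0); first by rewrite size_tuple hs.
move=> k; rewrite size_tuple => hk.
by rewrite -[k]/(nat_of_ord (Ordinal hk)) -tnth_nth tnth_mktuple.
Qed.

Lemma tuple_of_id n (w : n.-tuple F) : tuple_of n w = w.
Proof. by apply/val_inj; rewrite /= tuple_ofK // size_tuple. Qed.

(* F (x)_{K_{i+1}} F (x)_{K_{i+2}} ... (x)_{K_{i+n-1}} F  (n factors): the free
   abelian group on n-tuples, modulo additivity in each factor and
   K_{i+r}-balancedness between the factors r and r+1 *)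
Inductive tensor_rel (i : int) (n : nat) : {freeg (n.-tuple F) / int} -> Prop :=
| tensor_add (u v : seq F) (a b : F) : size (u ++ a :: v) = n ->
    tensor_rel i (<< tuple_of n (u ++ (a + b) :: v) >>
                  - << tuple_of n (u ++ a :: v) >>
                  - << tuple_of n (u ++ b :: v) >>)
| tensor_bal (u v : seq F) (a c b : F) : size (u ++ a :: b :: v) = n ->
    c \in K (i + (size u).+1%:Z) ->
    tensor_rel i (<< tuple_of n (u ++ (a * c) :: b :: v) >>
                  - << tuple_of n (u ++ a :: (c * b) :: v) >>).

Definition tensor (i : int) (n : nat) : zmodType :=
  Quotient.quot (subgroup_gen (@tensor_rel i n)).

Definition tensor_pi i n (x : {freeg (n.-tuple F) / int}) : tensor i n :=
  \pi_(Quotient.quot (subgroup_gen (@tensor_rel i n))) x.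

(* s_1 (x) ... (x) s_n, when s has size n *)
Definition pure i n (s : seq F) : tensor i n := tensor_pi i << tuple_of n s >>.

Lemma tensor_ind i n (P : tensor i n -> Prop) :
  P 0 -> (forall x y, P x -> P y -> P (x - y)) ->
  (forall s, size s = n -> P (pure i n s)) -> forall x, P x.
Proof.
move=> P0 PB P1 x; rewrite -[x]reprK; elim/freeg_ind: (repr x) => [|y z Py Pz|w].
- by rewrite raddf0.
- by rewrite raddfB; apply: PB.
- by rewrite -(tuple_of_id w); apply: P1; rewrite size_tuple.
Qed.

Lemma pureD i n u v a b : size (u ++ a :: v) = n ->
  pure i n (u ++ (a + b) :: v) = pure i n (u ++ a :: v) + pure i n (u ++ b :: v).
Proof.
move=> hs; rewrite -[LHS](subrK (pure i n (u ++ b :: v))).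
congr (_ + _); apply/eqP; rewrite -subr_eq0; apply/eqP.
rewrite /pure /tensor_pi -!piB; apply: pi_eq0; rewrite addrAC.
by apply/asboolP/sg_gen; apply: tensor_add.
Qed.

Lemma pureM i n u v a c b : size (u ++ a :: b :: v) = n ->
  c \in K (i + (size u).+1%:Z) ->
  pure i n (u ++ (a * c) :: b :: v) = pure i n (u ++ a :: (c * b) :: v).
Proof.
move=> hs hc; apply: pi_eqP.
by apply/asboolP/sg_gen; apply: tensor_bal.
Qed.

Definition lscal (a : F) (s : seq F) : seq F :=
  if s is x :: s' then a * x :: s' else [::].

Definition rscal (s : seq F) (a : F) : seq F :=
  if s is x :: s' then rcons (belast x s') (last x s' * a) else [::].

Definition tensor_mapF m n (f : seq F -> seq F) :
    {freeg (m.-tuple F) / int} -> {freeg (n.-tuple F) / int} :=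
  fglift (fun w : m.-tuple F => << tuple_of n (f w) >>).

Definition tensor_map i j m n (f : seq F -> seq F) (x : tensor i m) :
  tensor j n := tensor_pi j (tensor_mapF n f (repr x)).

Definition tensor_mul2F m n p (x : {freeg (m.-tuple F) / int})
    (y : {freeg (n.-tuple F) / int}) : {freeg (p.-tuple F) / int} :=
  fglift (fun u : m.-tuple F =>
    fglift (fun v : n.-tuple F =>
      << tuple_of p (u ++ v) >> : {freeg (p.-tuple F) / int}) y) x.

Definition tensor_mul i j m n p (x : tensor i m) (y : tensor j n) :
  tensor i p := tensor_pi i (tensor_mul2F p (repr x) (repr y)).

Lemma tensor_lift i n (W : zmodType) (G : {freeg (n.-tuple F) / int} -> W) :
  (forall x y, G (x - y) = G x - G y) ->
  (forall x, tensor_rel i x -> G x = 0) ->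
  forall x, G (repr (tensor_pi i x)) = G x.
Proof.
move=> GB G0 x; apply/eqP; rewrite -subr_eq0 -GB; apply/eqP.
have /asboolP := repr_pi (subgroup_gen (@tensor_rel i n)) x.
elim=> [y /G0 //|| y z _ hy _ hz]; last by rewrite GB hy hz subr0.
by rewrite -(subrr 0) GB subrr.
Qed.

Lemma tensor_piB i n (x y : {freeg (n.-tuple F) / int}) :
  tensor_pi i (x - y) = tensor_pi i x - tensor_pi i y.
Proof. exact: piB. Qed.

Section Map.
Variables (i j : int) (m n : nat) (f : seq F -> seq F).
Hypothesis fD : forall u v a b, size (u ++ a :: v) = m ->
  pure j n (f (u ++ (a + b) :: v))
    = pure j n (f (u ++ a :: v)) + pure j n (f (u ++ b :: v)).
Hypothesis fM : forall u v a c b, size (u ++ a :: b :: v) = m ->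
  c \in K (i + (size u).+1%:Z) ->
  pure j n (f (u ++ (a * c) :: b :: v)) = pure j n (f (u ++ a :: (c * b) :: v)).

Lemma tensor_mapE (x : {freeg (m.-tuple F) / int}) :
  tensor_map j n f (tensor_pi i x) = tensor_pi j (tensor_mapF n f x).
Proof.
apply: (@tensor_lift i m _ (fun x => tensor_pi j (tensor_mapF n f x))).
  by move=> y z; rewrite [tensor_mapF _ _ _]fgliftB tensor_piB.
move=> _ [u v a b hs|u v a c b hs hc];
  rewrite /tensor_mapF !fgliftB !fglift1 !tensor_piB.
  have hs' : size (u ++ b :: v) = m by move: hs; rewrite !size_cat.
  have hs'' : size (u ++ (a + b) :: v) = m by move: hs; rewrite !size_cat.
  by rewrite !tuple_ofK //; move: (fD b hs); rewrite /pure => ->; rewrite addrAC addrK subrr.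
rewrite !tuple_ofK //; try by move: hs; rewrite !size_cat.
by move: (fM hs hc); rewrite /pure => ->; rewrite subrr.
Qed.

Lemma tensor_mapB (x y : tensor i m) :
  tensor_map j n f (x - y) = tensor_map j n f x - tensor_map j n f y.
Proof.
rewrite -[x]reprK -[y]reprK -piB.
by rewrite !tensor_mapE [tensor_mapF _ _ _]fgliftB tensor_piB.
Qed.

Lemma tensor_map_pure s : size s = m ->
  tensor_map j n f (pure i m s) = pure j n (f s).
Proof. by move=> hs; rewrite tensor_mapE /tensor_mapF fglift1 tuple_ofK. Qed.

End Map.

Lemma mul2FBl m n p (x x' : {freeg (m.-tuple F) / int})
    (y : {freeg (n.-tuple F) / int}) :
  tensor_mul2F p (x - x') y = tensor_mul2F p x y - tensor_mul2F p x' y.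
Proof. exact: fgliftB. Qed.

Lemma mul2F0l m n p (y : {freeg (n.-tuple F) / int}) :
  tensor_mul2F p (0 : {freeg (m.-tuple F) / int}) y = 0.
Proof. by rewrite -(subrr 0) mul2FBl subrr. Qed.

Lemma mul2F1 m n p (u : m.-tuple F) (v : n.-tuple F) :
  tensor_mul2F p << u >> << v >> = << tuple_of p (u ++ v) >>.
Proof. by rewrite /tensor_mul2F !fglift1. Qed.

Lemma mul2FBr m n p (x : {freeg (m.-tuple F) / int})
    (y y' : {freeg (n.-tuple F) / int}) :
  tensor_mul2F p x (y - y') = tensor_mul2F p x y - tensor_mul2F p x y'.
Proof.
elim/freeg_ind: x => [|x x' IH IH'|u]; first by rewrite !mul2F0l subr0.
  by rewrite !mul2FBl IH IH' !opprD !addrA; congr (_ + _); rewrite addrAC.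
by rewrite /tensor_mul2F !fglift1 fgliftB.
Qed.

Lemma mul2F0r m n p (x : {freeg (m.-tuple F) / int}) :
  tensor_mul2F p x (0 : {freeg (n.-tuple F) / int}) = 0.
Proof. by rewrite -(subrr 0) mul2FBr subrr. Qed.

Section Mul.
Variables (i j : int) (m n p : nat).
Hypotheses (hj : j = i + m%:Z) (hp : p = (m + n)%N).

Lemma tensor_mulE (x : {freeg (m.-tuple F) / int})
    (y : {freeg (n.-tuple F) / int}) :
  tensor_mul p (tensor_pi i x) (tensor_pi j y) = tensor_pi i (tensor_mul2F p x y).
Proof.
pose G y' x' := tensor_pi i (@tensor_mul2F m n p x' y').
have G0l y' : G y' 0 = 0 by rewrite /G mul2F0l; apply: raddf0.
have G0r x' : G 0 x' = 0 by rewrite /G mul2F0r; apply: raddf0.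
have GBl y' x1 x2 : G y' (x1 - x2) = G y' x1 - G y' x2.
  by rewrite /G mul2FBl tensor_piB.
have GBr x' y1 y2 : G (y1 - y2) x' = G y1 x' - G y2 x'.
  by rewrite /G mul2FBr tensor_piB.
rewrite /tensor_mul -/(G _ _).
rewrite (@tensor_lift i m _ (G _)) //; last first.
  move=> _ [u v a b hs|u v a c b hs hc];
    elim/freeg_ind: (repr _) => [|y1 y2 IH1 IH2|w];
    rewrite ?G0r // ?(GBr _ y1) ?IH1 ?IH2 ?subrr // !GBl /G !mul2F1 !tuple_ofK;
    rewrite -?catA /=; try by move: hs; rewrite !size_cat.
    have := @pureD i p u (v ++ w) a b.
    rewrite /pure => ->; first by rewrite addrAC addrK subrr.
    by move: hs; rewrite hp !size_cat /= size_cat size_tuple; lia.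
  have := @pureM i p u (v ++ w) a c b.
  rewrite /pure => -> //; first by rewrite subrr.
  by move: hs; rewrite hp !size_cat /= size_cat size_tuple; lia.
apply: (@tensor_lift j n _ (fun y' => G y' x)) => //.
move=> _ [u v a b hs|u v a c b hs hc];
  elim/freeg_ind: x => [|x1 x2 IH1 IH2|w];
  rewrite ?G0l ?subrr // ?(GBl _ x1) ?IH1 ?IH2 ?subrr //.
  rewrite !GBr /G !mul2F1 !tuple_ofK; try by move: hs; rewrite !size_cat.
  have := @pureD i p (w ++ u) v a b; rewrite -!catA.
  rewrite /pure => ->; first by rewrite addrAC addrK subrr.
  by move: hs; rewrite hp !size_cat /= size_tuple; lia.
rewrite !GBr /G !mul2F1 !tuple_ofK; try by move: hs; rewrite !size_cat.
have := @pureM i p (w ++ u) v a c b; rewrite -!catA.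
rewrite /pure => ->; first by rewrite subrr.
  by move: hs; rewrite hp !size_cat /= size_tuple; lia.
by rewrite size_cat size_tuple -addnS PoszD addrA -hj.
Qed.

Lemma tensor_mulBl (x x' : tensor i m) (y : tensor j n) :
  tensor_mul p (x - x') y = tensor_mul p x y - tensor_mul p x' y.
Proof.
rewrite -[x]reprK -[x']reprK -[y]reprK -piB.
by rewrite !tensor_mulE mul2FBl tensor_piB.
Qed.

Lemma tensor_mulBr (x : tensor i m) (y y' : tensor j n) :
  tensor_mul p x (y - y') = tensor_mul p x y - tensor_mul p x y'.
Proof.
rewrite -[x]reprK -[y]reprK -[y']reprK -piB.
by rewrite !tensor_mulE mul2FBr tensor_piB.
Qed.

Lemma tensor_mul_pure s t : size s = m -> size t = n ->
  tensor_mul p (pure i m s) (pure j n t) = pure i p (s ++ t).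
Proof. by move=> hs ht; rewrite tensor_mulE mul2F1 !tuple_ofK. Qed.

End Mul.

Lemma tensor_eq i n (W : zmodType) (f g : tensor i n -> W) :
  (forall x y, f (x - y) = f x - f y) -> (forall x y, g (x - y) = g x - g y) ->
  (forall s, size s = n -> f (pure i n s) = g (pure i n s)) -> forall x, f x = g x.
Proof.
move=> fB gB fg; elim/tensor_ind => [|x y fx fy|s /fg //].
  by rewrite -(subrr 0) fB gB !subrr.
by rewrite fB gB fx fy.
Qed.

Lemma additiveD (V W : zmodType) (f : V -> W) :
  (forall x y, f (x - y) = f x - f y) -> forall x y, f (x + y) = f x + f y.
Proof.
move=> fB x y; have f0 : f 0 = 0 by rewrite -(subrr 0) fB subrr.
by rewrite -{1}[y]opprK fB -[- y]sub0r fB f0 sub0r opprK.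
Qed.

Lemma size_lscal a s : size (lscal a s) = size s.
Proof. by case: s. Qed.

Lemma size_rscal s a : size (rscal s a) = size s.
Proof. by case: s => //= x s; rewrite size_rcons size_belast. Qed.

Lemma rscal_rcons s x a : rscal (rcons s x) a = rcons s (x * a).
Proof.
by case: s => //= y s; rewrite last_rcons belast_rcons.
Qed.

Section Scal.
Variables (i : int) (n : nat).

Lemma lscalD c u v a b : size (u ++ a :: v) = n ->
  pure i n (lscal c (u ++ (a + b) :: v))
    = pure i n (lscal c (u ++ a :: v)) + pure i n (lscal c (u ++ b :: v)).
Proof.
case: u => [|x u] hs /=; first by rewrite mulrDr (@pureD i n [::]).
by rewrite -cat_cons pureD.
Qed.

Lemma lscalM d u v a c b : size (u ++ a :: b :: v) = n ->
  c \in K (i + (size u).+1%:Z) ->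
  pure i n (lscal d (u ++ (a * c) :: b :: v))
    = pure i n (lscal d (u ++ a :: (c * b) :: v)).
Proof.
case: u => [|x u] hs hc /=; first by rewrite mulrA (@pureM i n [::]).
by rewrite -cat_cons pureM.
Qed.

Lemma rscalD c u v a b : size (u ++ a :: v) = n ->
  pure i n (rscal (u ++ (a + b) :: v) c)
    = pure i n (rscal (u ++ a :: v) c) + pure i n (rscal (u ++ b :: v) c).
Proof.
case/lastP: v => [|v x] hs.
  rewrite !cats1 !rscal_rcons mulrDl -!cats1 pureD //.
  by move: hs; rewrite !size_cat.
rewrite -!rcons_cons -!rcons_cat !rscal_rcons !rcons_cat !rcons_cons pureD //.
by move: hs; rewrite !size_cat /= !size_rcons.
Qed.

Lemma rscalM d u v a c b : size (u ++ a :: b :: v) = n ->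
  c \in K (i + (size u).+1%:Z) ->
  pure i n (rscal (u ++ (a * c) :: b :: v) d)
    = pure i n (rscal (u ++ a :: (c * b) :: v) d).
Proof.
case/lastP: v => [|v x] hs hc.
  have E y z : u ++ [:: y; z] = rcons (rcons u y) z by rewrite -!cats1 -catA.
  rewrite !E !rscal_rcons -!E -mulrA pureM //.
  by move: hs; rewrite !size_cat.
rewrite -!rcons_cons -!rcons_cat !rscal_rcons !rcons_cat !rcons_cons pureM //.
by move: hs; rewrite !size_cat /= !size_rcons.
Qed.

End Scal.

Definition tensor_upl i j n p (a : F) (x : tensor j n.+1) : tensor i p.+1 :=
  tensor_map i p.+1 (lscal a) x.

Definition tensor_upr i n p (x : tensor i n.+1) (a : F) : tensor i p.+1 :=
  tensor_map i p.+1 (rscal^~ a) x.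

Definition tensor_upm i j m n p (x : tensor i m.+1) (y : tensor j n.+1) :
  tensor i p.+1 := tensor_mul p.+1 x y.

Lemma tensor_uplB i n a (x y : tensor i n.+1) :
  tensor_upl i n a (x - y) = tensor_upl i n a x - tensor_upl i n a y.
Proof. by apply: tensor_mapB => *; [apply: lscalD|apply: lscalM]. Qed.

Lemma tensor_upl_pure i n a s : size s = n.+1 ->
  tensor_upl i n a (pure i n.+1 s) = pure i n.+1 (lscal a s).
Proof.
by move=> hs; apply: tensor_map_pure => // *; [apply: lscalD|apply: lscalM].
Qed.

Lemma tensor_uprB i n a (x y : tensor i n.+1) :
  tensor_upr n (x - y) a = tensor_upr n x a - tensor_upr n y a.
Proof. by apply: tensor_mapB => *; [apply: rscalD|apply: rscalM]. Qed.

Lemma tensor_upr_pure i n a s : size s = n.+1 ->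
  tensor_upr n (pure i n.+1 s) a = pure i n.+1 (rscal s a).
Proof.
by move=> hs; apply: tensor_map_pure => // *; [apply: rscalD|apply: rscalM].
Qed.

Section Upm.
Variables (i j : int) (m n p : nat).
Hypotheses (hj : j = i + m.+1%:Z) (hp : p = (m + n).+1).

Let hp' : p.+1 = (m.+1 + n.+1)%N.
Proof. by rewrite hp addSn addnS. Qed.

Lemma tensor_upmBl (x x' : tensor i m.+1) (y : tensor j n.+1) :
  tensor_upm p (x - x') y = tensor_upm p x y - tensor_upm p x' y.
Proof. exact: tensor_mulBl. Qed.

Lemma tensor_upmBr (x : tensor i m.+1) (y y' : tensor j n.+1) :
  tensor_upm p x (y - y') = tensor_upm p x y - tensor_upm p x y'.
Proof. exact: tensor_mulBr. Qed.

Lemma tensor_upm_pure s t : size s = m.+1 -> size t = n.+1 ->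
  tensor_upm p (pure i m.+1 s) (pure j n.+1 t) = pure i p.+1 (s ++ t).
Proof. exact: tensor_mul_pure. Qed.

End Upm.

Program Definition tensor_upper : upper K :=
  @Upper F K (fun i n => tensor i n.+1) tensor_upl tensor_upr tensor_upm
    _ _ _ _ _ _ _ _ _ _ _ _ _ _ _.
Next Obligation.
move: x; apply: tensor_eq => // [x y|s hs]; first exact: tensor_uplB.
by rewrite tensor_upl_pure //; case: s hs => //= x s; rewrite mul1r.
Qed.
Next Obligation.
move: x; apply: tensor_eq => [x y|x y|s hs]; rewrite ?tensor_uplB //.
rewrite !tensor_upl_pure ?size_lscal //.
by case: s hs => //= x s; rewrite mulrA.
Qed.
Next Obligation.
move: x; apply: tensor_eq => [x y|x y|s hs]; rewrite ?tensor_uplB //.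
  by rewrite opprD !addrA; congr (_ + _); rewrite addrAC.
rewrite !tensor_upl_pure //; case: s hs => //= x s hs.
by rewrite mulrDl (@pureD i _ [::]).
Qed.
Next Obligation. exact/additiveD/tensor_uplB. Qed.
Next Obligation.
move: x; apply: tensor_eq => // [x y|s hs]; first exact: tensor_uprB.
rewrite tensor_upr_pure //; case/lastP: s hs => // s x _.
by rewrite rscal_rcons mulr1.
Qed.
Next Obligation.
move: x; apply: tensor_eq => [x y|x y|s hs]; rewrite ?tensor_uprB //.
rewrite !tensor_upr_pure ?size_rscal //.
by case/lastP: s hs => // s x _; rewrite !rscal_rcons mulrA.
Qed.
Next Obligation. by apply: (additiveD (f := fun x => tensor_upr n x a)) => u v; apply: tensor_uprB. Qed.
Next Obligation.
move: x; apply: tensor_eq => [x y|x y|s hs]; rewrite ?tensor_uprB //.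
  by rewrite opprD !addrA; congr (_ + _); rewrite addrAC.
rewrite !tensor_upr_pure //; case/lastP: s hs => // s x hs.
by rewrite !rscal_rcons mulrDr -!cats1 pureD // cats1 -hs !size_rcons.
Qed.
Next Obligation.
move: x; apply: tensor_eq => [x y|x y|s hs];
  rewrite ?(tensor_uprB, tensor_uplB) //.
rewrite tensor_upr_pure // tensor_upl_pure ?size_rscal //.
rewrite tensor_upl_pure // tensor_upr_pure ?size_lscal //.
case/lastP: s hs => // s x _; rewrite rscal_rcons.
by case: s => [|y s] /=; rewrite ?last_rcons ?belast_rcons ?mulrA.
Qed.
Next Obligation.
apply: (additiveD (f := fun x => tensor_upm (m + n).+1 x y)) => u v.
exact: tensor_upmBl.
Qed.
Next Obligation.
apply: (additiveD (f := fun y => tensor_upm (m + n).+1 x y)) => u v.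
exact: tensor_upmBr.
Qed.
Next Obligation.
move: x; apply: tensor_eq => [u v|u v|s hs];
  rewrite ?(tensor_uplB, tensor_upmBl) //.
move: y; apply: tensor_eq => [u v|u v|t ht];
  rewrite ?(tensor_uplB, tensor_upmBr) //.
rewrite tensor_upl_pure // !tensor_upm_pure ?size_lscal //.
rewrite tensor_upl_pure ?size_cat ?hs ?ht ?addSn ?addnS //.
by case: s hs.
Qed.
Next Obligation.
move: x; apply: tensor_eq => [u v|u v|s hs];
  rewrite ?(tensor_uprB, tensor_upmBl) //.
move: y; apply: tensor_eq => [u v|u v|t ht];
  rewrite ?(tensor_uprB, tensor_upmBr) //.
rewrite tensor_upr_pure // !tensor_upm_pure ?size_rscal //.
rewrite tensor_upr_pure ?size_cat ?hs ?ht ?addSn ?addnS //.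
by case/lastP: t ht => // t x _; rewrite -rcons_cat !rscal_rcons rcons_cat.
Qed.
Next Obligation.
move: x; apply: tensor_eq => [u v|u v|s hs];
  rewrite ?(tensor_uprB, tensor_upmBl) //.
move: y; apply: tensor_eq => [u v|u v|t ht];
  rewrite ?(tensor_uplB, tensor_upmBr) //.
rewrite tensor_upr_pure // tensor_upl_pure //.
rewrite !tensor_upm_pure ?size_rscal ?size_lscal //.
case/lastP: s hs => // s x; rewrite size_rcons => -[hs].
case: t ht => // y t [ht].
rewrite rscal_rcons !cat_rcons pureM ?hs //.
by rewrite size_cat /= hs ht; lia.
Qed.
Next Obligation.
move: x; apply: tensor_eq => [u v|u v|s hs]; rewrite ?tensor_upmBl //; try lia.
move: y; apply: tensor_eq => [u v|u v|t ht];
  rewrite ?(tensor_upmBr, tensor_upmBl) //; try lia.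
move: z; apply: tensor_eq => [u v|u v|r hr]; rewrite ?tensor_upmBr //; try lia.
rewrite !tensor_upm_pure ?catA // ?size_cat ?hs ?ht ?hr; lia.
Qed.

End Tensor.

Section Twisted.
Variables (F : fieldType) (K : int -> divringClosed F).
Variable tau : int -> {rmorphism F -> F}.

(* G_i = {1, tau_i} is encoded by bool, with true standing for tau_i, and
   (s_{i+1},...,s_{i+n}) in G_{i+1} x ... x G_{i+n} by a sequence of booleans *)
Definition gact (i : int) (b : bool) (x : F) : F := if b then tau i x else x.

(* s_{i+1} o s_{i+2} o ... *)
Fixpoint sbar (i : int) (s : seq bool) (x : F) : F :=
  if s is b :: s' then gact (i + 1) b (sbar (i + 1) s' x) else x.

Definition btuple (n : nat) (s : seq bool) : n.-tuple bool :=
  [tuple nth false s r | r < n].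

Lemma gactB i b x y : gact i b (x - y) = gact i b x - gact i b y.
Proof. by case: b => //=; rewrite rmorphB. Qed.

Lemma gactD i b x y : gact i b (x + y) = gact i b x + gact i b y.
Proof. by case: b => //=; rewrite rmorphD. Qed.

Lemma gactM i b x y : gact i b (x * y) = gact i b x * gact i b y.
Proof. by case: b => //=; rewrite rmorphM. Qed.

Lemma gact1 i b : gact i b 1 = 1.
Proof. by case: b => //=; rewrite rmorph1. Qed.

Lemma sbarD i s x y : sbar i s (x + y) = sbar i s x + sbar i s y.
Proof. by elim: s i => //= b s IHs i; rewrite IHs gactD. Qed.

Lemma sbarM i s x y : sbar i s (x * y) = sbar i s x * sbar i s y.
Proof. by elim: s i => //= b s IHs i; rewrite IHs gactM. Qed.

Lemma sbar1 i s : sbar i s 1 = 1.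
Proof. by elim: s i => //= b s IHs i; rewrite IHs gact1. Qed.

Lemma sbar_cat i s t x : sbar i (s ++ t) x = sbar i s (sbar (i + (size s)%:Z) t x).
Proof.
elim: s i => [|b s IHs] i /=; first by rewrite addr0.
by rewrite IHs; congr gact; congr sbar; congr sbar; lia.
Qed.

Lemma sbar_split i m (u : seq bool) x : (m < size u)%N ->
  sbar i u x = sbar i (take m u) (gact (i + m.+1%:Z) (nth false u m)
                 (sbar (i + m.+1%:Z) (drop m.+1 u) x)).
Proof.
move=> hm; rewrite -{1}(cat_take_drop m u) sbar_cat size_takel 1?ltnW //.
rewrite (drop_nth false hm) /=; congr sbar.
by have -> : i + m%:Z + 1 = i + m.+1%:Z by lia.
Qed.

Lemma btupleE n s : (n <= size s)%N -> btuple n s = take n s :> seq bool.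
Proof.
move=> hs; apply: (@eq_from_nth _ false); first by rewrite size_tuple size_takel.
move=> k; rewrite size_tuple => hk.
by rewrite -[k]/(nat_of_ord (Ordinal hk)) -tnth_nth tnth_mktuple nth_take.
Qed.

Lemma btuple_id n (s : n.-tuple bool) : btuple n s = s.
Proof. by apply/val_inj; rewrite /= btupleE ?take_oversize ?size_tuple. Qed.

Lemma btuple_take n k s : (n <= k)%N -> btuple n (take k s) = btuple n s.
Proof.
move=> hk; apply: eq_from_tnth => r.
by rewrite !tnth_mktuple nth_take // (leq_trans (ltn_ord r)).
Qed.

Local Notation dsum n := {ffun n.-tuple bool -> F}.

Definition tw_upl (i j : int) n p (a : F) (x : dsum n) : dsum p :=
  [ffun s : p.-tuple bool => a * x (btuple n s)].

Definition tw_upr (i : int) n p (x : dsum n) (b : F) : dsum p :=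
  [ffun s : p.-tuple bool => x (btuple n s) * sbar i s b].

(* the component of x * y at u = (s, t, s'), with s in G_ij, t in G_j and
   s' in G_jl, is x_s sbar(t(y_s')) *)
Definition tw_upm (i j : int) m n p (x : dsum m) (y : dsum n) : dsum p :=
  [ffun u : p.-tuple bool =>
     x (btuple m u) *
     sbar i (take m u) (gact j (nth false u m) (y (btuple n (drop m.+1 u))))].

Definition tw_in n (s : n.-tuple bool) (a : F) : dsum n :=
  [ffun u => if u == s then a else 0].

Lemma tw_upm_in i j m n (s : m.-tuple bool) (s' : n.-tuple bool) a b :
  let inj t := tw_in (btuple (m + n).+1 (s ++ t :: s')) in
  tw_upm i j (m + n).+1 (tw_in s a) (tw_in s' b)
  = inj false (a * sbar i s b) + inj true (a * sbar i s (tau j b)).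
Proof.
have sbar0 (k : int) t : sbar k t 0 = 0.
  by apply: (addrI (sbar k t 0)); rewrite -sbarD !addr0.
have gact0 (k : int) t : gact k t 0 = 0 by case: t; rewrite /= ?rmorph0.
move=> inj; apply/ffunP => u; rewrite !ffunE.
have hu := size_tuple u.
have hst t : btuple (m + n).+1 (s ++ t :: s') = s ++ t :: s' :> seq bool.
  have h : size (s ++ t :: s') = (m + n).+1.
    by rewrite size_cat /= !size_tuple addnS.
  by rewrite btupleE ?take_oversize ?h.
have hm : (m < size u)%N by rewrite hu; lia.
have uE : u = take m u ++ nth false u m :: drop m.+1 u :> seq bool.
  by rewrite -(drop_nth false hm) cat_take_drop.
have eqE t : (u == btuple (m + n).+1 (s ++ t :: s'))
    = [&& btuple m u == s, nth false u m == t & btuple n (drop m.+1 u) == s'].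
  rewrite -!val_eqE /= hst {1}uE eqseq_cat ?size_takel ?size_tuple //; last lia.
  by rewrite eqseq_cons !btupleE ?(take_oversize (s := drop _ _)) // ?size_drop ?hu; lia.
rewrite !eqE; case: eqP => [es|_] /=; last by rewrite mul0r addr0.
have -> : take m u = s by rewrite -es btupleE // hu; lia.
case: (btuple n _ == s'); last first.
  by rewrite gact0 sbar0 mulr0 !andbF addr0.
by case: (nth false u m); rewrite /= ?addr0 ?add0r.
Qed.

Hypothesis tauK : forall i x, x \in K i -> tau i x = x.

Lemma gactK i b x : x \in K i -> gact i b x = x.
Proof. by case: b => //= /tauK. Qed.

Program Definition tw_upper : upper K :=
  @Upper F K (fun i n => {ffun n.-tuple bool -> F}) tw_upl tw_upr tw_upm
    _ _ _ _ _ _ _ _ _ _ _ _ _ _ _.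
Next Obligation. by apply/ffunP => s; rewrite !ffunE !btuple_id mul1r. Qed.
Next Obligation. by apply/ffunP => s; rewrite !ffunE !btuple_id mulrA. Qed.
Next Obligation. by apply/ffunP => s; rewrite !ffunE mulrDl. Qed.
Next Obligation. by apply/ffunP => s; rewrite !ffunE mulrDr. Qed.
Next Obligation. by apply/ffunP => s; rewrite !ffunE !btuple_id sbar1 mulr1. Qed.
Next Obligation. by apply/ffunP => s; rewrite !ffunE !btuple_id sbarM mulrA. Qed.
Next Obligation. by apply/ffunP => s; rewrite !ffunE mulrDl. Qed.
Next Obligation. by apply/ffunP => s; rewrite !ffunE sbarD mulrDr. Qed.
Next Obligation. by apply/ffunP => s; rewrite !ffunE !btuple_id mulrA. Qed.
Next Obligation. by apply/ffunP => s; rewrite !ffunE mulrDl. Qed.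
Next Obligation.
by apply/ffunP => s; rewrite !ffunE gactD sbarD mulrDr.
Qed.
Next Obligation.
by apply/ffunP => s; rewrite !ffunE !btuple_id mulrA.
Qed.
Next Obligation.
apply/ffunP => u; rewrite !ffunE !btuple_id -mulrA; congr (_ * _).
have hu := size_tuple u.
have e2 : btuple n (drop m.+1 u) = drop m.+1 u :> seq bool.
  have hd : size (drop m.+1 u) = n by rewrite size_drop hu; lia.
  by rewrite btupleE ?take_oversize ?hd.
by rewrite (@sbar_split i m u) ?hu ?ltnS ?leq_addr // -sbarM -gactM e2.
Qed.
Next Obligation.
apply/ffunP => u; rewrite !ffunE !btuple_id -mulrA; congr (_ * _).
have hu := size_tuple u.
have e1 : btuple m u = take m u :> seq bool by rewrite btupleE // hu; lia.
by rewrite e1 gactM (@gactK _ _ a) // -sbarM.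
Qed.
Next Obligation.
apply/ffunP => u; rewrite !ffunE.
have hu := size_tuple u.
have e1 : btuple (m + n).+1 u = take (m + n).+1 u :> seq bool.
  by rewrite btupleE // hu; lia.
have e2 : btuple (n + q).+1 (drop m.+1 u) = drop m.+1 u :> seq bool.
  have hd : size (drop m.+1 u) = (n + q).+1 by rewrite size_drop hu; lia.
  by rewrite btupleE ?take_oversize ?hd.
rewrite -mulrA e1 e2.
have hk : (m < (m + n).+1)%N by lia.
have e3 : drop m.+1 (take (m + n).+1 u) = take n (drop m.+1 u).
  by rewrite take_drop; congr (drop _ (take _ _)); lia.
have e4 : take m (take (m + n).+1 u) = take m u by rewrite take_takel // ltnW.
rewrite (@sbar_split i m (take (m + n).+1 u)) ?size_takel ?hu //; last by lia.
rewrite nth_take // e3 e4 !btuple_take // ?(ltnW hk) //.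
rewrite nth_drop drop_drop -sbarM -gactM.
have -> : (m.+1 + n = (m + n).+1)%N by lia.
by have -> : (n.+1 + m.+1 = (m + n).+2)%N by lia.
Qed.

End Twisted.

Definition by_parity (T : Type) (x0 x1 : T) (i : int) : T :=
  if (2 %| i)%Z then x0 else x1.

Definition bimod_iso (A B : Type) (M N : zmodType)
    (actM : A -> M -> B -> M) (actN : A -> N -> B -> N) : Prop :=
  exists f : {additive M -> N},
    bijective f /\ forall a x b, f (actM a x b) = actN a (f x) b.

Section Algebras.
Variables (F : fieldType) (K0 K1 : divringClosed F).
Local Notation K := (by_parity K0 K1).

Definition tensor_alg : zalg := upper_zalg (tensor_upper K).

Definition comp_pure (i d : int) (s : seq F) : comp (tensor_upper K) i d :=
  match d with Posz n.+1 => pure K i n.+1 s | _ => 0 end.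

(* s_1 (x) ... (x) s_{j-i} in T_ij, when i < j and s has size j - i *)
Definition pure_tensor (i j : int) (s : seq F) : tensor_alg i j :=
  comp_pure i (j - i) s.

Section NCSym.
Variable w : int -> F.

Inductive nc_rel : forall i j, tensor_alg i j -> Prop :=
| NcRel i : nc_rel (pure_tensor i (i + 2) [:: 1; 1]
                    + pure_tensor i (i + 2) [:: (w (i + 1))^-1; w (i + 1)]).

Definition nc_sym : zalg := zquot nc_rel.

Definition nc_sym_act (i j : int) (a : subfield (K i)) (x : nc_sym i j)
    (b : subfield (K j)) : nc_sym i j :=
  let pi k (c : subfield (K k)) : nc_sym k k :=
    zquot_pi nc_rel (upper_scal (tensor_upper K) c) in
  zmul (zmul (pi i a) x) (pi j b).

End NCSym.

Variables (t0 t1 : {rmorphism F -> F}).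
Local Notation tau := (by_parity t0 t1).

(* the automorphism attached to tau_{i,i+k} = (tau_{i+1}, ..., tau_{i+k-1}) *)
Definition tau_bar (i : int) (k : nat) : F -> F := sbar tau i (nseq k.-1 true).

(* K_i (+) F_{tau_{i,i+2}} (+) F_{tau_{i,i+4}} (+) ... (+) F_{tau_{i,i+2m}};
   its K_i-K_j-bimodule structure is used for j = i + 2m, so that K_j = K_i *)
Definition even_sum (i : int) (m : nat) : zmodType :=
  (subfield (K i) * {ffun 'I_m -> F})%type.

Definition even_act (i j : int) (m : nat) (a : subfield (K i))
    (x : even_sum i m) (b : subfield (K j)) : even_sum i m :=
  (to_sf (K i) (sfval a * sfval x.1 * sfval b),
   [ffun r : 'I_m => sfval a * x.2 r * tau_bar i r.+1.*2 (sfval b)]).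

(* F (+) F_{tau_{i,i+3}} (+) F_{tau_{i,i+5}} (+) ... (+) F_{tau_{i,i+2m+1}} *)
Definition odd_sum (m : nat) : zmodType := (F * {ffun 'I_m -> F})%type.

Definition odd_act (i j : int) (m : nat) (a : subfield (K i))
    (x : odd_sum m) (b : subfield (K j)) : odd_sum m :=
  (sfval a * x.1 * sfval b,
   [ffun r : 'I_m => sfval a * x.2 r * tau_bar i r.+1.*2.+1 (sfval b)]).

Hypotheses (g0 : gal_generator K0 t0) (g1 : gal_generator K1 t1).

Lemma by_parity_fix i x : x \in K i -> tau i x = x.
Proof.
by rewrite /by_parity; case: ifP => _; [case: g0|case: g1] => _ h _; apply: h.
Qed.

Definition twisted_alg : zalg := upper_zalg (tw_upper by_parity_fix).

End Algebras.

(* Main.v *)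
Require Import Defs.
From HB Require Import structures.
From mathcomp Require Import all_boot all_order all_algebra.
From mathcomp Require Import zify ring.
From mathcomp Require Import boolp freeg.

(* Let w^2 lie in K and tau w = -w.  Then F (x)_K F = F (+) F_tau through
   x (x) y |-> (x y, x tau(y)), the projections being
   (1 (x) 1 +- w^-1 (x) w) / 2.  Iterating, x_1 (x) ... (x) x_n goes to the family
   of all x_1 s_1(x_2 s_2(x_3 ...)), which is the isomorphism from T onto the
   twisted algebra; let e_s in T be the element corresponding to 1 in F_s.

   For the quotient, let D be the infinite dihedral group generated by two
   involutions tau_0 and tau_1, and choose signs c_p with c_(p+2) = - c_p.  In the
   twisted group ring of D over F,
   (1 + c_p tau_p) (1 + c_(p+2) tau_(p+2)) = 1 - tau_p^2 = 0, so that
     x_1 (x) ... (x) x_n |->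
       (1 + c_i tau_i) x_1 (1 + c_(i+1) tau_(i+1)) x_2 ... x_n (1 + c_j tau_j)
   kills the relations.  Conversely, modulo the relations a zero entry of s allows
   one to toggle both neighbouring entries up to sign, which reduces every F e_s to
   those with s = (1,...,1,0,...,0), where the number r of ones is 0 or has the
   parity of j - i - 1.  The coefficient at tau_(i+1) ... tau_(i+r) recovers the
   r-th coordinate, except when r = 0 and j - i is even: there it is
   a +- tau_i(a), and the a on which this vanishes are indeed in the ideal. *)

Set Implicit Arguments.
Unset Strict Implicit.
Unset Printing Implicit Defensive.

Import GRing.Theory.
Local Open Scope ring_scope.

(** * Quadratic extensions and their involution *)

Section QuadraticExtension.
Variables (F : fieldType) (K : divringClosed F).
Hypothesis index2 : degree2 K.

(** Cramer's rule, applied to the coordinates of 1 and [w] in the basis [e]. *)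
Lemma degree2_span (w z : F) : w \notin K ->
  exists a b : F, [/\ a \in K, b \in K & z = a + b * w].
Proof.
move=> wK; case: index2 => e he.
have coord x : exists p q : F, [/\ p \in K, q \in K & x = p * e ord0 + q * e ord_max].
  have [c [hc _]] := he x; exists (sfval (c ord0)), (sfval (c ord_max)); split; try exact: sfvalP.
  rewrite hc big_ord_recr big_ord1 /=.
  by have -> : widen_ord (leqnSn 1) ord0 = ord0 by apply: val_inj.
have [p [q [pK qK e1]]] := coord 1; have [r [s [rK sK ew]]] := coord w.
have [x [y [xK yK ez]]] := coord z.
have n1 : (1 : F) != 0 by apply: oner_neq0.
(* If this determinant vanished, 1 and [w] would be proportional over [K], and [w] would lie in
   [K]. *)
have d0 : p * s - q * r != 0.
  apply/eqP => d0; have hw : s = q * w.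
    have : s * 1 - q * w = (p * s - q * r) * e ord0 by rewrite e1 ew; ring.
    by rewrite d0 mul0r mulr1 => /eqP; rewrite subr_eq0 => /eqP.
  have [q0|q0] := eqVneq q 0.
    move: e1 ew; rewrite hw q0 !mul0r !addr0 => e1 ew.
    have p0 : p != 0 by apply: contraNneq n1 => p0; rewrite e1 p0 mul0r.
    have e0 : e ord0 = p^-1 by apply: (mulfI p0); rewrite -e1 divff.
    by move: wK; rewrite ew e0 rpredM // rpredV.
  have ew' : w = q^-1 * s by rewrite hw mulKf.
  by move: wK; rewrite ew' rpredM // rpredV.
exists ((x * s - y * r) / (p * s - q * r)), ((y * p - x * q) / (p * s - q * r)).
split; try by rewrite rpred_div ?rpredB ?rpredM.
rewrite ez -[X in _ = X + _]mulr1 {1}e1 ew.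
by field.
Qed.

(** [t w] is a square root of [w ^+ 2]; if it were [w], then [t] would be trivial on F = K + K w. *)
Lemma gal_generator_sqrt (t : {rmorphism F -> F}) (w : F) :
  gal_generator K t -> w \notin K -> w ^+ 2 \in K -> t w = - w.
Proof.
move=> [_ tK [x tx]] wK w2K.
have : t w ^+ 2 = w ^+ 2 by rewrite -rmorphXn tK.
move/eqP; rewrite eqf_sqr => /orP[] /eqP // tw.
have [a [b [aK bK ex]]] := degree2_span x wK.
by case: tx; rewrite ex rmorphD rmorphM (tK a) // (tK b) // tw.
Qed.

End QuadraticExtension.

(** * Maps out of the tensor algebra *)

Section TensorMaps.
Variables (F : fieldType) (K : int -> divringClosed F).

Section UniversalProperty.
Variables (W : zmodType) (i : int) (n : nat) (f : seq F -> W).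

(** [zmodule W] is the abelian group [W] seen as a module over the integers, as [fglift]
    requires. *)
Definition freeg_out : {freeg (n.-tuple F) / int} -> W :=
  @fglift int (zmodule W) _ (fun v : n.-tuple F => f v).

Lemma freeg_outB x y : freeg_out (x - y) = freeg_out x - freeg_out y.
Proof. exact: (@fgliftB _ (zmodule W)). Qed.

Lemma freeg_out1 v : freeg_out << v >> = f v.
Proof. exact: (@fglift1 _ (zmodule W)). Qed.

Definition tensor_out (x : tensor K i n) : W := freeg_out (repr x).

Hypothesis fD : forall u v a b, size (u ++ a :: v) = n ->
  f (u ++ (a + b) :: v) = f (u ++ a :: v) + f (u ++ b :: v).
Hypothesis fM : forall u v a c b, size (u ++ a :: b :: v) = n ->
  c \in K (i + (size u).+1%:Z) ->
  f (u ++ (a * c) :: b :: v) = f (u ++ a :: (c * b) :: v).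

Lemma tensor_outE x : tensor_out (tensor_pi K i x) = freeg_out x.
Proof.
apply: tensor_lift => [|_ [u v a b hs|u v a c b hs hc]]; first exact: freeg_outB.
  rewrite !freeg_outB !freeg_out1 !tuple_ofK; try by move: hs; rewrite !size_cat.
  by rewrite fD // addrAC addrK subrr.
rewrite !freeg_outB !freeg_out1 !tuple_ofK; try by move: hs; rewrite !size_cat.
by rewrite fM // subrr.
Qed.

Lemma tensor_outB x y : tensor_out (x - y) = tensor_out x - tensor_out y.
Proof. by rewrite -[x]reprK -[y]reprK -piB !tensor_outE freeg_outB. Qed.

Lemma tensor_out_pure s : size s = n -> tensor_out (pure K i n s) = f s.
Proof. by move=> hs; rewrite /pure tensor_outE freeg_out1 tuple_ofK. Qed.

End UniversalProperty.
End TensorMaps.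

Section Twist.
Variables (F : fieldType) (K : int -> divringClosed F).
Variable tau : int -> {rmorphism F -> F}.
Hypothesis tauK : forall i x, x \in K i -> tau i x = x.

(** The coordinate x_1 s_1(x_2 s_2(...)) of a pure tensor. Missing entries of [u] count as the
    identity, and the final 1 is fixed by whatever stands opposite the last factor. *)
Fixpoint twist (i : int) (v : seq F) (u : seq bool) : F :=
  if v is x :: v' then
    x * gact tau (i + 1) (head false u) (twist (i + 1) v' (behead u))
  else 1.

Lemma twistD i u v a b s :
  twist i (u ++ (a + b) :: v) s = twist i (u ++ a :: v) s + twist i (u ++ b :: v) s.
Proof.
elim: u i s => [|x u IHu] i s /=; first by rewrite mulrDl.
by rewrite IHu gactD mulrDr.
Qed.

Lemma twistM i u v a c b s : c \in K (i + (size u).+1%:Z) ->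
  twist i (u ++ (a * c) :: b :: v) s = twist i (u ++ a :: (c * b) :: v) s.
Proof.
elim: u i s => [|x u IHu] i s /= hc.
  by rewrite -!mulrA -{1}(gactK tauK (head false s) hc) -gactM mulrA.
by rewrite IHu //; have -> : i + 1 + (size u).+1%:Z = i + (size u).+2%:Z by lia.
Qed.

Lemma twist_lscal i a v u : v != [::] -> twist i (lscal a v) u = a * twist i v u.
Proof. by case: v => //= x v _; rewrite mulrA. Qed.

Lemma twist_rcons i v x y u :
  twist i (rcons v (x * y)) u = twist i (rcons v x) u * sbar tau i (take (size v) u) y.
Proof.
elim: v i u => [|z v IHv] i u /=; first by rewrite take0 /= !gact1 !mulr1.
rewrite IHv gactM mulrA; congr (_ * _).
have sbarF : forall k j, sbar tau j (nseq k false) y = y by elim=> //= k IHk j; exact: IHk.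
by case: u => //=.
Qed.

(** The entry of index [(size s).-1] sits at the junction: it is the component in G_j that [tw_upm]
    reads. *)
Lemma twist_cat i s t u : s != [::] -> (size s <= size u)%N ->
  twist i (s ++ t) u
  = twist i s u * sbar tau i (take (size s).-1 u)
      (gact tau (i + (size s)%:Z) (nth false u (size s).-1)
         (twist (i + (size s)%:Z) t (drop (size s) u))).
Proof.
elim: s i u => // x s IHs i [|b u] //= _.
case: (eqVneq s [::]) => [->|s0] /= hu; first by rewrite drop0 gact1 mulr1.
rewrite IHs // gactM mulrA.
case: s s0 hu {IHs} => // y s _ /= hu.
by rewrite !/(size _) /=; have -> : i + 1 + (size s).+1%:Z = i + (size s).+2%:Z by lia.
Qed.

Definition twist_map i n (x : tensor K i n.+1) : {ffun n.-tuple bool -> F} :=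
  [ffun u : n.-tuple bool => tensor_out (fun v => twist i v u) x].

Lemma twist_mapB i n (x y : tensor K i n.+1) :
  twist_map (x - y) = twist_map x - twist_map y.
Proof.
apply/ffunP => u; rewrite !ffunE tensor_outB // => *; [exact: twistD|exact: twistM].
Qed.

Lemma twist_map_pure i n s u : size s = n.+1 ->
  twist_map (pure K i n.+1 s) u = twist i s u.
Proof.
move=> hs; rewrite ffunE tensor_out_pure // => *; [exact: twistD|exact: twistM].
Qed.

Lemma twist_map_upl i n a (x : tensor K i n.+1) :
  twist_map (tensor_upl i n a x) = tw_upl i i n a (twist_map x).
Proof.
move: x; apply: tensor_eq => [x y|x y|s hs].
- by rewrite tensor_uplB twist_mapB.
- by rewrite twist_mapB; apply/ffunP => u; rewrite !ffunE mulrBr.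
apply/ffunP => u; rewrite tensor_upl_pure // twist_map_pure ?size_lscal //.
rewrite ffunE twist_map_pure // btuple_id twist_lscal //.
by rewrite -size_eq0 hs.
Qed.

Lemma twist_map_upr i n a (x : tensor K i n.+1) :
  twist_map (tensor_upr n x a) = tw_upr tau i n (twist_map x) a.
Proof.
move: x; apply: tensor_eq => [x y|x y|s hs].
- by rewrite tensor_uprB twist_mapB.
- by rewrite twist_mapB; apply/ffunP => u; rewrite !ffunE mulrBl.
apply/ffunP => u; rewrite tensor_upr_pure // twist_map_pure ?size_rscal //.
rewrite ffunE twist_map_pure // btuple_id.
case/lastP: s hs => // s x; rewrite size_rcons => -[hs].
by rewrite rscal_rcons twist_rcons take_oversize // size_tuple hs.
Qed.

Lemma twist_map_upm i j m n (x : tensor K i m.+1) (y : tensor K j n.+1) :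
  j = i + m.+1%:Z ->
  twist_map (tensor_upm (m + n).+1 x y)
  = tw_upm tau i j (m + n).+1 (twist_map x) (twist_map y).
Proof.
move=> hj.
have sgB k s a b : sbar tau k s (a - b) = sbar tau k s a - sbar tau k s b.
  by elim: s k => //= c s IHs k; rewrite IHs gactB.
move: x; apply: tensor_eq => [x x'|x x'|s hs].
- by rewrite tensor_upmBl // twist_mapB.
- by rewrite twist_mapB; apply/ffunP => u; rewrite !ffunE mulrBl.
move: y; apply: tensor_eq => [y y'|y y'|t ht].
- by rewrite tensor_upmBr // twist_mapB.
- by rewrite twist_mapB; apply/ffunP => u; rewrite !ffunE gactB sgB mulrBr.
apply/ffunP => u; rewrite tensor_upm_pure // twist_map_pure; last first.
  by rewrite size_cat hs ht addSn addnS.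
rewrite ffunE !twist_map_pure // twist_cat ?hs -?size_eq0 ?hs //; last first.
  by rewrite size_tuple; lia.
have hu := size_tuple u.
have e2 : btuple n (drop m.+1 u) = drop m.+1 u :> seq bool.
  have hd : size (drop m.+1 u) = n by rewrite size_drop hu; lia.
  by rewrite btupleE ?take_oversize ?hd.
rewrite hj e2 /=; congr (_ * _).
have -> : btuple m u = take m u :> seq bool by rewrite btupleE // hu; lia.
(* What remains: [s] has m + 1 factors, so its twist depends only on the first m entries of [u]. *)
clear -hs; move: (tval u) => {}u.
elim: s m i hs u => //= x s IHs [|m] i [hs] u.
  by case: s hs {IHs} => //= _; rewrite !gact1.
by case: u => //= b u'; rewrite (IHs m).
Qed.

End Twist.

(** * The tensor algebra as a left vector space *)

Section LeftModule.
Variables (F : fieldType) (K : int -> divringClosed F).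

(** A separate name, to which the action of the whole of [F] on the first factor is attached as a
    vector space structure. *)
Definition ltensor_sort (i : int) (n : nat) : Type := tensor K i n.+1.

HB.instance Definition _ i n := GRing.Zmodule.on (ltensor_sort i n).

HB.instance Definition _ i n := @GRing.Zmodule_isLmodule.Build F (ltensor_sort i n)
  (tensor_upl i n) (@uplA _ _ (tensor_upper K) i n) (@upl1 _ _ (tensor_upper K) i n)
  (fun a x y => @uplDr _ _ (tensor_upper K) i n a x y)
  (fun x a b => @uplDl _ _ (tensor_upper K) i n a b x).

(* T_{i,i+n+1} as a vector space over the leftmost factor F *)
Definition ltensor (i : int) (n : nat) : lmodType F := ltensor_sort i n.

End LeftModule.

(** * Isomorphisms given by their components above the diagonal *)

Section UpperIsomorphism.
Variables (F : fieldType) (K : int -> divringClosed F) (U V : upper K).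
Variable f : forall i n, U i n -> V i n.
Hypothesis fB : forall i n, {morph @f i n : x y / x - y}.
Hypothesis f_bij : forall i n, bijective (@f i n).
Hypothesis fl : forall i n a (x : U i n), f (upl i n a x) = upl i n a (f x).
Hypothesis fr : forall i n a (x : U i n), f (upr n x a) = upr n (f x) a.
Hypothesis fm : forall i j m n (x : U i m) (y : U j n), j = i + m.+1%:Z ->
  f (upm (m + n).+1 x y) = upm (m + n).+1 (f x) (f y).

(** On the diagonal both algebras are [K i], and below it both vanish, so [f] is extended by the
    identity. *)
Definition comp_map i d : Defs.comp U i d -> Defs.comp V i d :=
  match d with Posz 0 => id | Posz n.+1 => @f i n | Negz _ => id end.

Lemma comp_mapB i d : zmod_morphism (@comp_map i d).
Proof. by case: d => [[|n]|n] x y //=; apply: fB. Qed.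

Lemma comp_map_bij i d : bijective (@comp_map i d).
Proof. by case: d => [[|n]|n] /=; [exists id|apply: f_bij|exists id]. Qed.

Lemma comp_map_scal i d (a : subfield (K i)) : comp_map (comp_scal U d a) = comp_scal V d a.
Proof. by case: d => [[|n]|n] //=; rewrite -(subrr 0) fB subrr. Qed.

Lemma comp_mapM i j d d' e (x : Defs.comp U i d) (y : Defs.comp U j d') :
  j = i + d -> e = d + d' ->
  comp_map (comp_mul e x y) = comp_mul e (comp_map x) (comp_map y).
Proof.
have f0 k n : @f k n 0 = 0 by rewrite -(subrr 0) fB subrr.
case: d x => [[|m]|m] x; case: d' y => [[|n]|n] y; case: e => [[|p]|p] //= hj he.
- have [ij np] : j = i /\ n = p by lia.
  by clear hj he; subst j p; rewrite fl.
- have -> : p = m by lia.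
  exact: fr.
- have -> : p = (m + n).+1 by lia.
  by apply: fm; lia.
Qed.

HB.instance Definition _ i j :=
  GRing.isZmodMorphism.Build (upper_comp U i j) (upper_comp V i j)
    (@comp_map i (j - i)) (@comp_mapB i (j - i)).

Lemma upper_zalg_iso : zalg_iso (upper_zalg U) (upper_zalg V).
Proof.
pose g i j : {additive upper_comp U i j -> upper_comp V i j} := @comp_map i (j - i).
exists g; split=> [i j|i j l x y|i]; first exact: comp_map_bij.
  by apply: comp_mapM; lia.
exact: comp_map_scal.
Qed.

End UpperIsomorphism.

(** * The decomposition of the tensor algebra *)

Section Splitting.
Variables (F : fieldType) (K0 K1 : divringClosed F).
Variables (t0 t1 : {rmorphism F -> F}) (w : int -> F).
Local Notation K := (by_parity K0 K1).
Local Notation tau := (by_parity t0 t1).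
Hypothesis two_neq0 : (2 : F) != 0.
Hypothesis tauK : forall i x, x \in K i -> tau i x = x.
Hypothesis tauw : forall i, tau i (w i) = - w i.
Hypothesis w_notin : forall i, w i \notin K i.
Hypothesis w2_in : forall i, w i ^+ 2 \in K i.
Hypothesis w_span : forall i z,
  exists a b : F, [/\ a \in K i, b \in K i & z = a + b * w i].

Local Notation T := (ltensor K).

Lemma w_neq0 i : w i != 0.
Proof. by apply: contraNneq (w_notin i) => ->; rewrite rpred0. Qed.

Lemma tau_fixed i x : tau i x = x -> x \in K i.
Proof.
have [a [b [aK bK ->]]] := w_span i x.
rewrite rmorphD rmorphM tauw !tauK // => /addrI.
rewrite mulrN => /eqP; rewrite eq_sym -addr_eq0 -mulr2n -mulr_natr.
by rewrite !mulf_eq0 (negPf two_neq0) (negPf (w_neq0 i)) !orbF => /eqP ->; rewrite mul0r addr0.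
Qed.

Lemma tau_invol i x : tau i (tau i x) = x.
Proof.
have [a [b [aK bK ->]]] := w_span i x.
by rewrite !(rmorphD, rmorphM, rmorphN, tauw) !tauK // opprK.
Qed.

(** The element 1 (x) t, locked against unfolding; its left multiples are the x (x) t. *)
Definition tens1 i n (t : T (i + 1) n) : T i n.+1 :=
  locked (tensor_upm n.+1 (pure K i 1 [:: 1]) t).

Lemma tens1_upm i n (t : T (i + 1) n) :
  tens1 t = tensor_upm n.+1 (pure K i 1 [:: 1]) t.
Proof. by rewrite /tens1 -lock. Qed.

Lemma tens1B i n (x y : T (i + 1) n) : tens1 (x - y) = tens1 x - tens1 y.
Proof. by rewrite !tens1_upm; apply: tensor_upmBr. Qed.

Lemma tens1D i n (x y : T (i + 1) n) : tens1 (x + y) = tens1 x + tens1 y.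
Proof. by apply: additiveD => {}x {}y; apply: tens1B. Qed.

Lemma tens1_0 i n : tens1 (0 : T (i + 1) n) = 0.
Proof. by rewrite -(subrr 0) tens1B subrr. Qed.

Lemma tens1_pure i n s : size s = n.+1 ->
  tens1 (pure K (i + 1) n.+1 s) = pure K i n.+2 (1 :: s).
Proof. by move=> hs; rewrite tens1_upm tensor_upm_pure. Qed.

Lemma scale_pure i n a x s : size s = n ->
  a *: (pure K i n.+1 (x :: s) : T i n) = pure K i n.+1 (a * x :: s).
Proof. by move=> hs; rewrite -[LHS]/(tensor_upl i n a _) tensor_upl_pure //= hs. Qed.

Lemma pure_cons i n x s : size s = n.+1 ->
  pure K i n.+2 (x :: s) = x *: tens1 (pure K (i + 1) n.+1 s).
Proof. by move=> hs; rewrite tens1_pure // scale_pure ?mulr1. Qed.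

Lemma tens1Z i n (c : F) (t : T (i + 1) n) : c \in K (i + 1) ->
  tens1 (c *: t) = c *: tens1 t.
Proof.
move=> cK; set one := pure K i 1 [:: 1].
have hC := @upmC _ _ (tensor_upper K) i (i + 1) 0 n n.+1 erefl erefl c one t cK.
have hl := @upml _ _ (tensor_upper K) i (i + 1) 0 n n.+1 erefl erefl c one t.
rewrite !tens1_upm; apply: etrans (esym hC) (etrans _ (esym hl)).
by congr tensor_upm; rewrite /= tensor_upr_pure // tensor_upl_pure //= mulr1 mul1r.
Qed.

Lemma twist_map_tens1 i n (t : T (i + 1) n) u :
  twist_map tau (tens1 t) u
  = gact tau (i + 1) (head false u) (twist_map tau t (btuple n (behead u))).
Proof.
move: t; apply: tensor_eq => [x y|x y|s hs].
- by rewrite tens1B twist_mapB // !ffunE.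
- by rewrite twist_mapB // !ffunE gactB.
rewrite tens1_pure // !twist_map_pure //= ?hs // mul1r.
have hu : size (behead u) = n by rewrite size_behead size_tuple.
by rewrite btupleE ?take_oversize ?hu.
Qed.

Lemma twist_mapZ i n a (t : T i n) u : twist_map tau (a *: t) u = a * twist_map tau t u.
Proof. by rewrite [a *: t]/(tensor_upl i n a t) twist_map_upl // ffunE btuple_id. Qed.

(* the projections of F (x)_K t onto its two tau-isotypic parts *)
Definition eproj i n (b : bool) (t : T (i + 1) n) : T i n.+1 :=
  locked ((2^-1 : F) *: (tens1 t
     + ((-1) ^+ b * (w (i + 1))^-1 : F) *: tens1 (w (i + 1) *: t))).

Lemma eprojE i n b (t : T (i + 1) n) : eproj b t = (2^-1 : F) *: (tens1 t
  + ((-1) ^+ b * (w (i + 1))^-1 : F) *: tens1 (w (i + 1) *: t)).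
Proof. by rewrite /eproj -lock. Qed.

Lemma eprojB i n b (x y : T (i + 1) n) : eproj b (x - y) = eproj b x - eproj b y.
Proof.
rewrite !eprojE -scalerBr; congr (_ *: _).
by rewrite (scalerBr (w _)) !tens1B scalerBr addrACA -opprD.
Qed.

Lemma eprojD i n b (x y : T (i + 1) n) : eproj b (x + y) = eproj b x + eproj b y.
Proof. by apply: (additiveD (f := @eproj i n b)) => {}x {}y; apply: eprojB. Qed.

(** This semilinearity makes the part labelled [b] a twisted copy. It suffices to check it on
    [K (i + 1)] and on [w (i + 1)]. *)
Lemma eprojZ i n b z (t : T (i + 1) n) :
  eproj b (z *: t) = gact tau (i + 1) b z *: eproj b t.
Proof.
have w0 := w_neq0 (i + 1).
have eK (c : F) u : c \in K (i + 1) -> eproj b (c *: u) = c *: (eproj b u : T i n.+1).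
  move=> cK; have ec : w (i + 1) *: (c *: u) = c *: (w (i + 1) *: u).
    by rewrite !scalerA mulrC.
  rewrite !eprojE ec !(tens1Z _ cK) !scalerDr !scalerA.
  by congr (_ *: _ + _ *: _); ring.
(* As w^2 lies in K, passing from [t] to [w *: t] swaps the two summands up to a left factor w or
   -w. *)
have ew : eproj b (w (i + 1) *: t) = ((-1) ^+ b * w (i + 1)) *: (eproj b t : T i n.+1).
  rewrite !eprojE scalerA -expr2 (tens1Z _ (w2_in _)) addrC !scalerDr !scalerA.
  by congr (_ *: _ + _ *: _); clear eK; case: b => /=; field; rewrite ?two_neq0 ?w0.
have [a [c [aK cK ->]]] := w_span (i + 1) z.
rewrite scalerDl eprojD -scalerA (eK a) // (eK c) // ew (scalerA c) -scalerDl.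
congr (_ *: _); clear eK ew; case: b => /=; last by ring.
by rewrite rmorphD rmorphM tauw (tauK aK) (tauK cK); ring.
Qed.

Lemma eproj_lin i n b y z (t u : T (i + 1) n) : eproj b (y *: t + z *: u)
  = gact tau (i + 1) b y *: eproj b t + gact tau (i + 1) b z *: eproj b u.
Proof. by rewrite eprojD (eprojZ b y t) (eprojZ b z u). Qed.

Lemma tens1E i n (t : T (i + 1) n) : tens1 t = eproj false t + eproj true t.
Proof.
rewrite !eprojE -scalerDr addrACA -scalerDl !mul1r mulN1r subrr scale0r addr0.
by rewrite -mulr2n -scaler_nat scalerA mulVf // scale1r.
Qed.

Lemma twist_map_eproj i n b (t : T (i + 1) n) u :
  twist_map tau (eproj b t) u
  = if head false u == b
    then gact tau (i + 1) b (twist_map tau t (btuple n (behead u))) else 0.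
Proof.
have D (x y : T i n.+1) : twist_map tau (x + y) u = twist_map tau x u + twist_map tau y u.
  by rewrite (additiveD (f := fun x => twist_map tau x u)) // => {}x {}y; rewrite twist_mapB // !ffunE.
rewrite !eprojE twist_mapZ D twist_mapZ !twist_map_tens1 twist_mapZ gactM.
have w0 := w_neq0 (i + 1).
by case: (head false u); case: b; rewrite /= ?tauw; field; rewrite ?two_neq0 ?w0.
Qed.

(** The element e_s. Missing entries of [s] count as [false], so [[::]] stands for (0,...,0) and
    [nseq r true] for (1,...,1,0,...,0) with r ones. *)
Fixpoint ebasis i n (s : seq bool) : T i n :=
  match n with
  | 0 => pure K i 1 [:: 1]
  | n'.+1 => eproj (head false s) (ebasis (i + 1) n' (behead s))
  end.

Lemma twist_map_ebasis i n (s u : n.-tuple bool) :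
  twist_map tau (ebasis i n s) u = (u == s)%:R.
Proof.
elim: n i s u => [|n IHn] i s u /=.
  by rewrite twist_map_pure //= gact1 mulr1 [u]tuple0 [s]tuple0 eqxx.
rewrite twist_map_eproj.
have -> : behead s = btuple n (behead s) :> seq bool.
  by rewrite btupleE ?take_oversize // size_behead size_tuple.
rewrite IHn; case/tupleP: s => b s; case/tupleP: u => c u.
have hb (v : n.-tuple bool) d : btuple n (behead [tuple of d :: v]) = v.
  exact: btuple_id.
rewrite !hb -(val_eqE (cons_tuple c u)) eqseq_cons val_eqE [head _ _]/= [head _ _]/=.
case: (c == b) => //=; case: (_ == _); rewrite ?gact1 //.
by case: b => //=; rewrite rmorph0.
Qed.

Lemma big_tuple_bool (V : nmodType) n (f : n.+1.-tuple bool -> V) :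
  \sum_s f s = \sum_(s : n.-tuple bool) (f [tuple of false :: s] + f [tuple of true :: s]).
Proof.
pose cons_pair (p : bool * n.-tuple bool) := [tuple of p.1 :: p.2].
rewrite (reindex cons_pair) /=; last first.
  exists (fun s => (thead s, [tuple of behead s])) => [[b s] _|s _].
    by rewrite /cons_pair /= theadE; congr (_, _); apply: val_inj.
  by apply: val_inj; case/tupleP: s.
by rewrite -(pair_bigA _ (fun b (s : n.-tuple bool) => f [tuple of b :: s])) big_bool /= addrC -big_split.
Qed.

(** Expand the tail by induction and split the leading 1 (x) - by [tens1E]; semilinearity of [eproj]
    then reproduces the recursion of [twist]. *)
Lemma ebasis_span i n (t : T i n) :
  t = \sum_(s : n.-tuple bool) twist_map tau t s *: ebasis i n s.
Proof.
elim: n i t => [|n IHn] i t.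
  rewrite (bigD1 [tuple]) //= big1 => [|s]; last by rewrite tuple0.
  rewrite addr0; move: t; apply: tensor_eq => // [x y|[|x []] //= _].
    by rewrite twist_mapB // !ffunE scalerBl.
  by rewrite twist_map_pure //= ?gact1 mulr1 scale_pure // mulr1.
move: t; apply: tensor_eq => // [x y|[|x s] //= [hs]].
  by rewrite -sumrB; apply: eq_bigr => s _; rewrite twist_mapB // !ffunE scalerBl.
rewrite [LHS]pure_cons // big_tuple_bool {1}[pure K (i + 1) n.+1 s]IHn.
rewrite (big_morph (@tens1 i n) (@tens1D i n) (@tens1_0 i n)) scaler_sumr.
apply: eq_bigr => u _; rewrite tens1E !eprojZ scalerDr !scalerA.
by rewrite !twist_map_pure //= hs.
Qed.

Lemma twist_map_bij i n : bijective (@twist_map F K tau i n).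
Proof.
pose inv (g : {ffun n.-tuple bool -> F}) : T i n := \sum_(s : n.-tuple bool) g s *: ebasis i n s.
exists inv => [t|g]; first by rewrite /inv -ebasis_span.
apply/ffunP => u; rewrite /inv.
have D (x y : T i n) : twist_map tau (x + y) u = twist_map tau x u + twist_map tau y u.
  by rewrite (additiveD (f := fun x => twist_map tau x u)) // => {}x {}y; rewrite twist_mapB // !ffunE.
have Z : twist_map tau (0 : T i n) u = 0.
  by apply: (addrI (twist_map tau (0 : T i n) u)); rewrite -D !addr0.
rewrite (big_morph (fun x : T i n => twist_map tau x u) D Z) (bigD1 u) //= big1 => [|s su].
  by rewrite twist_mapZ twist_map_ebasis eqxx mulr1 addr0.
by rewrite twist_mapZ twist_map_ebasis eq_sym (negPf su) mulr0.
Qed.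

(** * The twisted group ring of the dihedral group *)

Lemma by_parity2 (X : Type) (x0 x1 : X) i : by_parity x0 x1 (i + 2) = by_parity x0 x1 i.
Proof. by rewrite /by_parity; have -> : (2 %| i + 2)%Z = (2 %| i)%Z by lia. Qed.

(* The infinite dihedral group acts simply transitively on the chambers of the
   line, which are indexed by int; g is encoded by the chamber g.0, and functions
   int -> F stand for elements of the twisted group ring. *)
Definition reflect_chamber (p x : int) : int := if (2 %| p)%Z then - 1 - x else 1 - x.

(** For r >= 0 the chamber [chamber_sign i * r] encodes tau_(i+1) ... tau_(i+r); negative multiples
    encode words beginning with tau_i. *)
Definition chamber_sign (i : int) : int := if (2 %| i)%Z then 1 else - 1.

(** The values run 1, 1, -1, -1 from p = 0 on, with period 4: a solution of c_(p+2) = - c_p. *)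
Definition csign (p : int) : F := if (2 %| (p %/ 2)%Z)%Z then 1 else - 1.

Local Notation rho := reflect_chamber.
Local Notation sg := chamber_sign.
Local Notation c := csign.

Lemma csign2 p : c (p + 2) = - c p.
Proof.
rewrite /csign; have -> : (2 %| ((p + 2) %/ 2)%Z)%Z = ~~ (2 %| (p %/ 2)%Z)%Z by lia.
by case: (2 %| _)%Z; rewrite /= ?opprK.
Qed.

Lemma csignM p : c p * c p = 1.
Proof. by rewrite /csign; case: ifP; rewrite ?mulrNN mulr1. Qed.

Lemma tau_csign p q : tau p (c q) = c q.
Proof. by rewrite /csign; case: ifP; rewrite ?rmorphN rmorph1. Qed.

Lemma reflect_reflect p x : rho p (rho p x) = x.
Proof. by rewrite /rho; case: (2 %| p)%Z; lia. Qed.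

Lemma reflect_chamber2 p x : rho (p + 2) x = rho p x.
Proof. by rewrite /rho; have -> : (2 %| p + 2)%Z = (2 %| p)%Z by lia. Qed.

Lemma reflect_first i x : rho i (sg i * x) = sg i * (- 1 - x).
Proof. by rewrite /rho /sg; case: (2 %| i)%Z; lia. Qed.

Lemma reflect_next i x : rho (i + 1) (sg i * x) = sg (i + 1) * (x - 1).
Proof.
rewrite /rho /sg; have -> : (2 %| i + 1)%Z = ~~ (2 %| i)%Z by lia.
by case: (2 %| i)%Z => /=; lia.
Qed.

Lemma reflect_chamber_double i k x : rho (i + k.*2%:Z) x = rho i x.
Proof. by rewrite /rho; have -> : (2 %| i + k.*2%:Z)%Z = (2 %| i)%Z by lia. Qed.

Lemma chamber_sign_eq0 i x : (sg i * x == 0) = (x == 0).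
Proof. by rewrite /sg; case: (2 %| i)%Z; lia. Qed.

(* left multiplication by 1 + c_p tau_p *)
Definition demazure (p : int) (m : int -> F) (x : int) : F :=
  m x + c p * tau p (m (rho p x)).

Local Notation D := demazure.

Lemma demazureB p m m' x : D p (fun y => m y - m' y) x = D p m x - D p m' x.
Proof. by rewrite /demazure rmorphB; ring. Qed.

Lemma demazureD p m m' x : D p (fun y => m y + m' y) x = D p m x + D p m' x.
Proof. by rewrite /demazure rmorphD; ring. Qed.

Lemma demazureZ p a m x : a \in K p -> D p (fun y => a * m y) x = a * D p m x.
Proof. by move=> aK; rewrite /demazure rmorphM tauK //; ring. Qed.

Lemma demazure0 p m x : (forall y, m y = 0) -> D p m x = 0.
Proof. by move=> m0; rewrite /demazure !m0 rmorph0 mulr0 addr0. Qed.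

Lemma demazure_ext p m m' x : m =1 m' -> D p m x = D p m' x.
Proof. by move=> e; rewrite /demazure !e. Qed.

(** The involutions at p and p + 2 agree and the signs are opposite: (1 + c tau)(1 - c tau) = 1 -
    tau^2 = 0. *)
Lemma demazure_demazure2 p m x : D p (D (p + 2) m) x = 0.
Proof.
rewrite /demazure csign2 !reflect_chamber2 reflect_reflect by_parity2.
rewrite rmorphD rmorphM rmorphN tau_csign tau_invol.
have -> : m x + - c p * tau p (m (rho p x))
    + c p * (tau p (m (rho p x)) + - c p * m x) = m x - c p * c p * m x by ring.
by rewrite csignM mul1r subrr.
Qed.

(* x_1 (1 + c tau) x_2 (1 + c tau) ... x_n (1 + c tau) *)
Fixpoint demazure_word (i : int) (s : seq F) (m : int -> F) (x : int) : F :=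
  if s is a :: s' then a * D (i + 1) (demazure_word (i + 1) s' m) x else m x.

Lemma demazure_wordD i u v a b m x :
  demazure_word i (u ++ (a + b) :: v) m x
  = demazure_word i (u ++ a :: v) m x + demazure_word i (u ++ b :: v) m x.
Proof.
elim: u i x => [|y u IHu] i x /=; first by rewrite mulrDl.
by rewrite -mulrDr -demazureD; congr (_ * _); apply: demazure_ext.
Qed.

Lemma demazure_wordM i u v a k b m x : k \in K (i + (size u).+1%:Z) ->
  demazure_word i (u ++ (a * k) :: b :: v) m x
  = demazure_word i (u ++ a :: (k * b) :: v) m x.
Proof.
elim: u i x => [|y u IHu] i x /= hk.
  rewrite -mulrA; congr (_ * _); rewrite -demazureZ //.
  by apply: demazure_ext => z; rewrite mulrA.
congr (_ * _); apply: demazure_ext => z; apply: IHu.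
by have -> : i + 1 + (size u).+1%:Z = i + (size u).+2%:Z by lia.
Qed.

Lemma demazure_word_ext i s m m' : m =1 m' -> demazure_word i s m =1 demazure_word i s m'.
Proof.
by elim: s i => //= a s IHs i e x; congr (_ * _); apply: demazure_ext; apply: IHs.
Qed.

Lemma demazure_wordB i s m m' x :
  demazure_word i s (fun y => m y - m' y) x = demazure_word i s m x - demazure_word i s m' x.
Proof.
elim: s i x => //= a s IHs i x; rewrite -mulrBr -demazureB.
by congr (_ * _); apply: demazure_ext.
Qed.

Lemma demazure_word_cat i s t m x :
  demazure_word i (s ++ t) m x
  = demazure_word i s (demazure_word (i + (size s)%:Z) t m) x.
Proof.
elim: s i x => [|a s IHs] i x /=; first by rewrite addr0.
congr (_ * _); apply: demazure_ext => y; rewrite IHs.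
by have -> : i + 1 + (size s)%:Z = i + (size s).+1%:Z by lia.
Qed.

Lemma demazure_word_last0 i s m x : s != [::] ->
  (forall y, D (i + (size s)%:Z) m y = 0) -> demazure_word i s m x = 0.
Proof.
elim: s i x => //= a s IHs i x _ hm.
case: (eqVneq s [::]) hm => [->|s0] /= hm; first by rewrite hm mulr0.
rewrite demazure0 ?mulr0 // => y; apply: IHs => // z; rewrite -(hm z).
by congr D; lia.
Qed.

(** Left multiplication by x_1 (1 + c tau_(i+1)) ... x_n (1 + c tau_j). The outer factor 1 + c_i
    tau_i is left out here, so that products in T become compositions. *)
Definition demazure_act i n (t : T i n) (m : int -> F) (x : int) : F :=
  tensor_out (fun s => demazure_word i s m x) t.

Local Notation Om := demazure_act.

Lemma demazure_actB i n (t t' : T i n) m x : Om (t - t') m x = Om t m x - Om t' m x.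
Proof.
by apply: tensor_outB => *; [exact: demazure_wordD|exact: demazure_wordM].
Qed.

Lemma demazure_actD i n (t t' : T i n) m x : Om (t + t') m x = Om t m x + Om t' m x.
Proof. by apply: (additiveD (f := fun t => Om t m x)) => {}t {}t'; apply: demazure_actB. Qed.

Lemma demazure_act_pure i n s m x : size s = n.+1 ->
  Om (pure K i n.+1 s : T i n) m x = demazure_word i s m x.
Proof.
move=> hs; apply: tensor_out_pure => // *; [exact: demazure_wordD|exact: demazure_wordM].
Qed.

Lemma demazure_act_ext i n (t : T i n) m m' : m =1 m' -> Om t m =1 Om t m'.
Proof.
move=> e x; move: t; apply: tensor_eq => [t t'|t t'|s hs].
- exact: demazure_actB.
- exact: demazure_actB.
by rewrite !demazure_act_pure //; apply: demazure_word_ext.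
Qed.

Lemma demazure_act0 i n (t : T i n) m x :
  (forall y, D (i + n.+1%:Z) m y = 0) -> Om t m x = 0.
Proof.
move=> hm; move: t; apply: (tensor_eq (g := fun=> 0)) => [t t'|t t'|s hs].
- exact: demazure_actB.
- by rewrite subrr.
by rewrite demazure_act_pure // demazure_word_last0 ?hs // -size_eq0 hs.
Qed.

Lemma demazure_actZ i n a (t : T i n) m x : Om (a *: t) m x = a * Om t m x.
Proof.
move: t; apply: (tensor_eq (f := fun t : T i n => Om (a *: t) m x)
                           (g := fun t : T i n => a * Om t m x)) => [t t'|t t'|[|b s] // [hs]].
- by rewrite scalerBr demazure_actB.
- by rewrite demazure_actB mulrBr.
by rewrite scale_pure // !demazure_act_pure /= ?hs // mulrA.
Qed.

Lemma demazure_act_upr i n a (t : T i n) m x : a \in K (i + n.+1%:Z) ->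
  Om (tensor_upr n t a : T i n) m x = Om t (fun y => a * m y) x.
Proof.
move=> aK; move: t; apply: tensor_eq => [t t'|t t'|s hs].
- by rewrite tensor_uprB demazure_actB.
- by rewrite demazure_actB.
rewrite tensor_upr_pure // !demazure_act_pure ?size_rscal //.
case/lastP: s hs => // s b; rewrite size_rcons => -[hs].
rewrite rscal_rcons -!cats1 !demazure_word_cat; apply: demazure_word_ext => y /=.
by rewrite hs demazureZ ?mulrA //; move: aK; rewrite -addn1 PoszD addrA.
Qed.

Lemma demazure_act_upm i j m n p (t : T i m) (u : T j n) g x :
  j = i + m.+1%:Z -> p = (m + n).+1 ->
  Om (tensor_upm p t u : T i p) g x = Om t (Om u g) x.
Proof.
move=> hj hp; move: t; apply: tensor_eq => [t t'|t t'|s hs].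
- by rewrite tensor_upmBl // demazure_actB.
- by rewrite demazure_actB.
rewrite (demazure_act_pure _ _ _ hs); move: u.
apply: (tensor_eq (g := fun u : T j n => demazure_word i s (Om u g) x)) => [u u'|u u'|v hv].
- by rewrite tensor_upmBr // demazure_actB.
- by rewrite -demazure_wordB; apply: demazure_word_ext => y; apply: demazure_actB.
rewrite tensor_upm_pure // demazure_act_pure; last by rewrite size_cat hs hv; lia.
rewrite demazure_word_cat hs -hj; apply: demazure_word_ext => y.
by rewrite demazure_act_pure.
Qed.

Lemma demazure_act_tens1 i n (t : T (i + 1) n) m x :
  Om (tens1 t) m x = D (i + 1) (Om t m) x.
Proof.
move: t; apply: (tensor_eq (f := fun t : T (i + 1) n => Om (tens1 t) m x)) => [t t'|t t'|s hs].
- by rewrite tens1B demazure_actB.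
- by rewrite -demazureB; apply: demazure_ext => y; apply: demazure_actB.
rewrite tens1_pure // demazure_act_pure /= ?hs // mul1r; apply: demazure_ext => y.
by rewrite demazure_act_pure.
Qed.

(** Conjugation by w changes the sign of tau, so half the sum or difference of 1 + c tau and w^-1 (1
    + c tau) w isolates 1 or c tau. *)
Lemma demazure_act_eproj i n b (t : T (i + 1) n) m x :
  Om (eproj b t) m x
  = if b then c (i + 1) * tau (i + 1) (Om t m (rho (i + 1) x)) else Om t m x.
Proof.
rewrite eprojE demazure_actZ demazure_actD demazure_actZ !demazure_act_tens1.
have w0 := w_neq0 (i + 1).
rewrite (demazure_ext _ _ (demazure_actZ (w (i + 1)) t m)) /demazure rmorphM tauw.
by case: b => /=; field; rewrite two_neq0 w0.
Qed.

Fixpoint esign (i : int) (r : nat) : F :=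
  if r is r'.+1 then c (i + 1) * esign (i + 1) r' else 1.

Lemma tau_esign p i r : tau p (esign i r) = esign i r.
Proof. by elim: r i => [|r IHr] i /=; rewrite ?rmorph1 // rmorphM tau_csign IHr. Qed.

Lemma esignM i r : esign i r * esign i r = 1.
Proof. by elim: r i => [|r IHr] i /=; rewrite ?mulr1 // mulrACA IHr csignM mulr1. Qed.

Lemma sbar0 i s : sbar tau i s 0 = 0.
Proof. by apply: (addrI (sbar tau i s 0)); rewrite -sbarD !addr0. Qed.

Lemma demazure_act_ebasis0 i n m x :
  Om (ebasis i n [::]) m x = D (i + n.+1%:Z) m x.
Proof.
elim: n i x => [|n IHn] i x /=; first by rewrite demazure_act_pure //= mul1r.
rewrite demazure_act_eproj IHn; congr D; lia.
Qed.

(** Each entry 1 contributes c tau and each 0 contributes 1, which leaves the signed word tau_(i+1)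
    ... tau_(i+r) times 1 + c_j tau_j. *)
Lemma demazure_act_ebasis i n r m x : (r <= n)%N ->
  Om (ebasis i n (nseq r true)) m (sg i * x)
  = esign i r * sbar tau i (nseq r true)
      (D (i + n.+1%:Z) m (sg (i + r%:Z) * (x - r%:Z))).
Proof.
elim: r n i x => [|r IHr] [|n] i x //= hr; rewrite ?demazure_act_ebasis0 ?mul1r ?addr0 ?subr0 //.
rewrite demazure_act_eproj reflect_next IHr // rmorphM tau_esign mulrA.
have -> : i + 1 + n.+1%:Z = i + n.+2%:Z by lia.
have -> : i + 1 + r%:Z = i + r.+1%:Z by lia.
by have -> : x - 1 - r%:Z = x - r.+1%:Z by lia.
Qed.

(** * Symbols in the twisted group ring *)

Definition dirac (b : F) (x : int) : F := b * (x == 0)%:R.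

(** The group ring element attached to [t], times [b] on the right; varying [b] records the right
    action of K_j. *)
Definition symbol i n (t : T i n) (b : F) (x : int) : F := D i (Om t (dirac b)) x.

Lemma demazure_dirac p b x : b \in K p ->
  D p (dirac b) x = b * ((x == 0)%:R + c p * (rho p x == 0)%:R).
Proof. by move=> bK; rewrite /dirac demazureZ // /demazure rmorph_nat. Qed.

(** Expanding the two outer factors yields four group elements, at [sg i] times r, r + 1, -1 - r and
    -2 - r; of these only r and r + 1 are natural numbers. *)
Lemma symbol_ebasis i n r a b (x : nat) : (r <= n)%N -> odd n = odd r ->
  x != r.+1 -> b \in K (i + n.+1%:Z) ->
  symbol (a *: ebasis i n (nseq r true)) b (sg i * x%:Z)
  = a * esign i r * sbar tau i (nseq r true) b * (x == r)%:R.
Proof.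
move=> hr hn hx bK; rewrite /symbol /demazure reflect_first !demazure_actZ.
have nE : i + n.+1%:Z = i + r%:Z + 1 + ((n - r)./2).*2%:Z by lia.
have rhoE (v : int) : (rho (i + n.+1%:Z) (sg (i + r%:Z) * v) == 0) = (v == 1).
  by rewrite nE reflect_chamber_double reflect_next chamber_sign_eq0 subr_eq0.
rewrite !demazure_act_ebasis // !demazure_dirac // !rhoE !chamber_sign_eq0.
have -> : (x%:Z - r%:Z == 0) = (x == r) by lia.
have -> : (x%:Z - r%:Z == 1) = false by lia.
have -> : (- 1 - x%:Z - r%:Z == 0) = false by lia.
have -> : (- 1 - x%:Z - r%:Z == 1) = false by lia.
rewrite !mulr0 !addr0 mulr0 sbar0 !mulr0 rmorph0 mulr0 addr0.
by case: (x == r); rewrite ?mulr1 ?mulr0 ?sbar0 ?mulr0 // mulrA.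
Qed.

(** For odd [n] the outer reflections tau_i and tau_j coincide, and their product 1 contributes the
    second term. *)
Lemma symbol_ebasis0 i n a b : odd n -> b \in K (i + n.+1%:Z) ->
  symbol (a *: ebasis i n [::]) b 0 = (a + c i * c (i + n.+1%:Z) * tau i a) * b.
Proof.
move=> hn bK; rewrite /symbol /demazure !demazure_actZ !demazure_act_ebasis0.
have jE : i + n.+1%:Z = i + (n.+1./2).*2%:Z by lia.
have bi : b \in K i.
  by move: bK; rewrite jE; elim: (n.+1./2) => [|k IHk]; rewrite ?addr0 // doubleS -addn2 PoszD addrA by_parity2.
rewrite !demazure_dirac // {2 4}jE !reflect_chamber_double reflect_reflect eqxx.
have -> : (rho i 0 == 0) = false by rewrite /rho; case: (2 %| i)%Z.
rewrite mulr0 !addr0 add0r !mulr1 !rmorphM tau_csign (tauK bi); ring.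
Qed.

Lemma symbol_ebasis0_odd i n a b (x : nat) : odd n -> odd x -> b \in K (i + n.+1%:Z) ->
  symbol (a *: ebasis i n [::]) b (sg i * x%:Z) = 0.
Proof.
move=> hn hx bK; rewrite /symbol /demazure !demazure_actZ !demazure_act_ebasis0.
have jE : i + n.+1%:Z = i + (n.+1./2).*2%:Z by lia.
rewrite !demazure_dirac // {2 4}jE !reflect_chamber_double reflect_reflect.
rewrite reflect_first !chamber_sign_eq0.
have -> : (x%:Z == 0) = false by lia.
have -> : (- 1 - x%:Z == 0) = false by lia.
by rewrite !mulr0 !addr0 !mulr0 rmorph0 mulr0 addr0.
Qed.

(** * Vanishing of the action on the ideal *)

Local Notation U := (tensor_upper K).

Definition comp_act i d : Defs.comp U i d -> (int -> F) -> int -> F :=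
  match d return Defs.comp U i d -> (int -> F) -> int -> F with
  | Posz 0 => fun a m x => sfval a * m x
  | Posz n.+1 => fun t m x => Om (t : T i n) m x
  | Negz _ => fun _ _ _ => 0
  end.

Lemma comp_actB i d (t t' : Defs.comp U i d) m x :
  comp_act (t - t') m x = comp_act t m x - comp_act t' m x.
Proof.
case: d t t' => [[|n]|n] t t' /=; last by rewrite subr0.
  by rewrite -mulrBl.
exact: demazure_actB.
Qed.

Lemma comp_act0 i d m x : comp_act (0 : Defs.comp U i d) m x = 0.
Proof. by rewrite -(subrr 0) comp_actB subrr. Qed.

Lemma comp_act_ext i d (t : Defs.comp U i d) m m' : m =1 m' ->
  comp_act t m =1 comp_act t m'.
Proof.
case: d t => [[|n]|n] t e x //=; first by rewrite e.
exact: demazure_act_ext.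
Qed.

(** This handles left multiples in the ideal: scalars of K_i commute with 1 + c_i tau_i, and
    elements of positive degree end with the factor 1 + c_j tau_j that kills [m]. *)
Lemma demazure_comp_act0 i d (t : Defs.comp U i d) m x :
  (forall y, D (i + d) m y = 0) -> D i (comp_act t m) x = 0.
Proof.
case: d t => [[|n]|n] t hm; last by apply: demazure0.
  by rewrite demazureZ ?sfvalP // -[X in D X](addr0 i) hm mulr0.
by apply: demazure0 => y; apply: demazure_act0.
Qed.

Lemma comp_actM i j d d' e (t : Defs.comp U i d) (u : Defs.comp U j d') m x :
  j = i + d -> e = d + d' ->
  comp_act (comp_mul e t u) m x = comp_act t (comp_act u m) x.
Proof.
case: d t => [[|k]|k] t; case: d' u => [[|n]|n] u hj he.
- have ij : j = i by lia.
  have e0 : e = 0 by lia.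
  clear hj he; subst j e; rewrite /= to_sfK ?mulrA //.
  by rewrite rpredM ?sfvalP.
- have [ij en] : j = i /\ e = n.+1 by lia.
  by clear hj he; subst j e; apply: demazure_actZ.
- have -> : comp_mul e t u = 0 by case: e {he}.
  by rewrite comp_act0 /= mulr0.
- have ek : e = k.+1 by lia.
  clear he; subst e j; apply: demazure_act_upr; exact: sfvalP.
- have ek : e = (k + n).+2 by lia.
  by clear he; subst e; apply: demazure_act_upm.
- have -> : comp_mul e t u = 0 by case: e {he}.
  by rewrite comp_act0 /= demazure_act0 // => y; apply: demazure0.
- by have -> : comp_mul e t u = 0; [case: e {he}|rewrite comp_act0].
- by have -> : comp_mul e t u = 0; [case: e {he}|rewrite comp_act0].
- by have -> : comp_mul e t u = 0; [case: e {he}|rewrite comp_act0].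
Qed.

Local Notation R := (in_ideal (@nc_rel F K0 K1 w)).

(** In h_i the two contributions of tau_(i+1) cancel, so h_i acts as 2 (1 + c_(i+2) tau_(i+2)),
    which 1 + c_i tau_i annihilates. *)
Lemma nc_rel_act i d m x : d = 2 ->
  D i (comp_act (comp_pure K0 K1 i d [:: 1; 1]
        + comp_pure K0 K1 i d [:: (w (i + 1))^-1; w (i + 1)]) m) x = 0.
Proof.
move=> ->; have w0 := w_neq0 (i + 1).
pose g := D (i + 2) m.
have hg y : comp_act (comp_pure K0 K1 i 2 [:: 1; 1]
        + comp_pure K0 K1 i 2 [:: (w (i + 1))^-1; w (i + 1)]) m y = 2 * g y.
  rewrite [comp_act _ _ _]demazure_actD !demazure_act_pure //= !mul1r.
  have -> : i + 1 + 1 = i + 2 by lia.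
  rewrite (@demazure_ext _ _ g) => [|z]; last by rewrite mul1r.
  move: (D (i + 2) m) @g => g; rewrite /demazure rmorphM tauw.
  by field.
rewrite (demazure_ext _ _ hg) /= demazureZ ?demazure_demazure2 ?mulr0 //.
by rewrite rpredMn ?rpred1.
Qed.

Lemma ideal_act i j (t : tensor_alg K0 K1 i j) m x : R t -> D i (comp_act t m) x = 0.
Proof.
move=> Rt; elim: Rt m x => {i j t} [_ _ _ [i]|i j|i j t u _ IHt _ IHu|i j l a t _ IH|i j l t a _ IH] m x.
- by apply: nc_rel_act; lia.
- by apply: demazure0 => y; apply: comp_act0.
- by rewrite (demazure_ext _ _ (comp_actB t u m)) demazureB IHt IHu subrr.
- have hM := fun y => @comp_actM i j _ _ (l - i) a t m y.
  rewrite (demazure_ext _ _ (fun y => hM y _ _)); try lia.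
  by apply: demazure_comp_act0 => y; rewrite -(IH m y); congr D; lia.
- have hM := fun y => @comp_actM i j _ _ (l - i) t a m y.
  rewrite (demazure_ext _ _ (fun y => hM y _ _)); try lia.
  exact: IH.
Qed.

(** * Relations modulo the ideal *)

(** Meant for d = n + 1, an equality that need not hold by computation: scaling by 1 changes the
    index without a transport. *)
Definition emb i d n (t : T i n) : Defs.comp U i d :=
  match d return Defs.comp U i d with
  | Posz k.+1 => tensor_upl i k 1 t
  | _ => 0
  end.

Lemma upl_id i n (t : T i n) : tensor_upl i n 1 t = t.
Proof. exact: (@upl1 _ _ U). Qed.

Lemma embB i (d : int) n (t u : T i n) : d = n.+1 -> emb d (t - u) = emb d t - emb d u.
Proof. by move=> ->; rewrite /= !upl_id. Qed.

Lemma emb_surj i (d : int) n (z : Defs.comp U i d) : d = n.+1 -> exists t : T i n, z = emb d t.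
Proof. by move=> hd; subst d; exists z; rewrite /= upl_id. Qed.

Lemma comp_act_emb i (d : int) n (t : T i n) m x : d = n.+1 ->
  comp_act (emb d t) m x = Om t m x.
Proof. by move=> hd; subst d; rewrite /= upl_id. Qed.

Lemma emb_mul i j (d d' e : int) m n p (t : T i m) (u : T j n) :
  d = m.+1 -> d' = n.+1 -> e = p.+1 ->
  comp_mul e (emb d t) (emb d' u) = emb e (tensor_upm p t u : T i p).
Proof. by move=> -> -> ->; rewrite /= !upl_id. Qed.

Lemma emb_scal i (d0 d : int) n (a : subfield (K i)) (t : T i n) : d0 = 0 -> d = n.+1 ->
  comp_mul d (comp_scal U d0 a) (emb d t) = emb d (sfval a *: t).
Proof. by move=> -> ->; rewrite /= !upl_id. Qed.

Definition rel_ideal i n (t : T i n) : Prop :=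
  forall j, j = i + n.+1%:Z -> R (emb (j - i) t : tensor_alg K0 K1 i j).

Lemma rel_idealB i n (t u : T i n) : rel_ideal t -> rel_ideal u -> rel_ideal (t - u).
Proof. by move=> ht hu j hj; rewrite embB; [apply: id_B; [exact: ht|exact: hu]|lia]. Qed.

Lemma rel_ideal0 i n : rel_ideal (0 : T i n).
Proof.
move=> j hj; have -> : emb (j - i) (0 : T i n) = 0; last exact: id_0.
by have := @embB i (j - i) n 0 0; rewrite !subrr; apply; lia.
Qed.

Lemma rel_idealN i n (t : T i n) : rel_ideal t -> rel_ideal (- t).
Proof. by move=> ht; rewrite -sub0r; apply: rel_idealB => //; apply: rel_ideal0. Qed.

Lemma rel_idealD i n (t u : T i n) : rel_ideal t -> rel_ideal u -> rel_ideal (t + u).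
Proof. by move=> ht hu; rewrite -[u]opprK; apply: rel_idealB => //; apply: rel_idealN. Qed.

Lemma rel_idealZ i n (a : F) (t : T i n) : a \in K i -> rel_ideal t -> rel_ideal (a *: t).
Proof.
move=> aK ht j hj.
have <- : comp_mul (j - i) (upper_scal U (to_sf (K i) a)) (emb (j - i) t) = emb (j - i) (a *: t).
  by rewrite emb_scal ?to_sfK //; lia.
by apply: (@id_Ml (tensor_alg K0 K1)); apply: ht.
Qed.

Lemma rel_ideal_upm i j m n p (t : T i m) (u : T j n) :
  j = i + m.+1%:Z -> p = (m + n).+1 -> rel_ideal t -> rel_ideal (tensor_upm p t u : T i p).
Proof.
move=> hj hp ht l hl.
have <- : comp_mul (l - i) (emb (j - i) t) (emb (l - j) u) = emb (l - i) (tensor_upm p t u : T i p).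
  by apply: emb_mul; lia.
by apply: (@id_Mr (tensor_alg K0 K1)); apply: ht.
Qed.

Lemma upm_scale i j m n p a (t : T i m) (u : T j n) : j = i + m.+1%:Z -> p = (m + n).+1 ->
  tensor_upm p (a *: t) u = a *: (tensor_upm p t u : T i p).
Proof. by move=> hj hp; apply: esym; apply: (@upml _ _ U). Qed.

Lemma scale_tens1 i n a (t : T (i + 1) n) :
  a *: tens1 t = tensor_upm n.+1 (pure K i 1 [:: a]) t.
Proof.
by rewrite tens1_upm -upm_scale // scale_pure // mulr1.
Qed.

(** The new first factor may be any element of F, whereas [rel_idealZ] allows only scalars of
    K_i. *)
Lemma rel_ideal_tens1 i n y (t : T (i + 1) n) : rel_ideal t -> rel_ideal (y *: tens1 t).
Proof.
move=> ht j hj.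
have <- : comp_mul (j - i) (emb (i + 1 - i) (pure K i 1 [:: y] : T i 0)) (emb (j - (i + 1)) t)
    = emb (j - i) (y *: tens1 t).
  by rewrite scale_tens1; apply: emb_mul; lia.
by apply: (@id_Ml (tensor_alg K0 K1)); apply: ht; lia.
Qed.

(** The generator h_i is twice the basis element e_(0). *)
Lemma ebasis1E i : ebasis i 1 [::] = (2^-1 : F) *:
  (pure K i 2 [:: 1; 1] + pure K i 2 [:: (w (i + 1))^-1; w (i + 1)] : T i 1).
Proof.
by rewrite /= eprojE expr0 mul1r scale_pure // mulr1 !tens1_pure // scale_pure // mulr1.
Qed.

Lemma rel_ideal_ebasis1 i (a : F) : a \in K i -> rel_ideal (a *: ebasis i 1 [::]).
Proof.
move=> aK; rewrite ebasis1E scalerA; apply: rel_idealZ.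
  by rewrite rpredM // rpredV rpredMn ?rpred1.
move=> j hj; have -> : j = i + 2 by lia.
set h := (_ + _ : T i 1).
have -> : emb (i + 2 - i) h = pure_tensor K0 K1 i (i + 2) [:: 1; 1]
    + pure_tensor K0 K1 i (i + 2) [:: (w (i + 1))^-1; w (i + 1)].
  have E (d : int) : d = 2 -> emb d h = comp_pure K0 K1 i d [:: 1; 1]
      + comp_pure K0 K1 i d [:: (w (i + 1))^-1; w (i + 1)].
    by move=> ->; rewrite /= upl_id.
  by apply: E; lia.
exact/id_gen/NcRel.
Qed.

Lemma upm_ebasis1 i n (t : T (i + 1 + 1) n) :
  tensor_upm n.+2 (ebasis i 1 [::]) t = eproj false (tens1 t).
Proof.
pose o1 := pure K i 1 [:: 1].
have A (v : T (i + 1) 0) : tensor_upm n.+2 (tens1 v) t = tens1 (tensor_upm n.+1 v t).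
  rewrite !tens1_upm.
  exact: (esym (@upmA _ _ U i (i + 1) (i + 1 + 1) 0 0 n n.+1 1 n.+2 _ _ _ _ _ o1 v t)).
rewrite /= !eprojE (@upm_scale i (i + 1 + 1) 1 n n.+2) //; last lia.
have S (u v : T i n.+2) : u = v -> (2^-1 : F) *: u = (2^-1 : F) *: v by move=> ->.
apply: S; rewrite [LHS](@upmDl _ _ U i (i + 1 + 1) 1 n n.+2) //; last lia.
have o1t : tensor_upm n.+1 (pure K (i + 1) 1 [:: 1]) t = tens1 t by rewrite [RHS]tens1_upm.
rewrite [upm _ _ _]A o1t; congr (_ + _).
rewrite [LHS](@upm_scale i (i + 1 + 1) 1 n n.+2) //; last lia.
by rewrite A upm_scale // o1t.
Qed.

(** Expand e_(0) (x) z t: the twisted part of 1 (x) z t picks up tau_(i+2)(z) = tau_i(z). *)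
Lemma rel_ideal_first i n z (t : T (i + 1 + 1) n) :
  rel_ideal (z *: eproj false (eproj false t) + tau i z *: eproj false (eproj true t)).
Proof.
have -> : z *: eproj false (eproj false t) + tau i z *: eproj false (eproj true t)
    = tensor_upm n.+2 (ebasis i 1 [::]) (z *: t).
  rewrite upm_ebasis1 tens1E (eprojZ false z t) (eprojZ true z t) (eproj_lin false) /=.
  have -> // : tau (i + 1 + 1) = tau i by rewrite -[RHS]by_parity2; congr by_parity; lia.
apply: (@rel_ideal_upm i (i + 1 + 1) 1 n n.+2 (ebasis i 1 [::]) (z *: t)) => //; first lia.
by rewrite -[ebasis _ _ _]scale1r; apply: rel_ideal_ebasis1; rewrite rpred1.
Qed.

(* the largest F-stable part of the ideal *)
Definition core_ideal i n (t : T i n) : Prop := forall y, rel_ideal (y *: t).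

Lemma core_rel i n (t : T i n) : core_ideal t -> rel_ideal t.
Proof. by move=> /(_ 1); rewrite scale1r. Qed.

Lemma core_idealB i n (t u : T i n) : core_ideal t -> core_ideal u -> core_ideal (t - u).
Proof. by move=> ht hu y; rewrite scalerBr; apply: rel_idealB. Qed.

Lemma core_idealD i n (t u : T i n) : core_ideal t -> core_ideal u -> core_ideal (t + u).
Proof. by move=> ht hu y; rewrite scalerDr; apply: rel_idealD. Qed.

Lemma core_idealZ i n a (t : T i n) : core_ideal t -> core_ideal (a *: t).
Proof. by move=> ht y; rewrite scalerA. Qed.

Lemma core_tens1 i n (t : T (i + 1) n) : rel_ideal t -> core_ideal (tens1 t).
Proof. by move=> ht y; apply: rel_ideal_tens1. Qed.

Lemma core_eproj i n b (t : T (i + 1) n) : core_ideal t -> core_ideal (eproj b t).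
Proof.
move=> ht; rewrite eprojE; apply/core_idealZ/core_idealD; first exact/core_tens1/core_rel.
exact/core_idealZ/core_tens1.
Qed.

(** The toggling rule at a zero with two neighbours. A factor 1 in front of [rel_ideal_first] gives
    z A + tau_(i+1)(z) B for every z. *)
Lemma core_interior i n (t : T (i + 1 + 1 + 1) n) :
  core_ideal (eproj false (eproj false (eproj false t)) + eproj true (eproj false (eproj true t)))
  /\ core_ideal (eproj false (eproj false (eproj true t)) + eproj true (eproj false (eproj false t))).
Proof.
set A := (_ + _ : T i n.+3); set B := (_ + _ : T i n.+3).
have AB z : core_ideal (z *: A + tau (i + 1) z *: B).
  have := core_tens1 (rel_ideal_first z t).
  rewrite tens1E (eproj_lin false) (eproj_lin true) /= tau_invol.
  by congr core_ideal; rewrite !scalerDr [RHS]addrACA; congr (_ + _); apply: addrC.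
clearbody A B.
(* z = 1 gives A + B, and z = [w (i + 1)] gives A - B after division by w. *)
have hD : core_ideal (A + B) by have := AB 1; rewrite rmorph1 !scale1r.
have hB : core_ideal (A - B).
  have := core_idealZ (w (i + 1))^-1 (AB (w (i + 1))).
  by rewrite tauw scaleNr -scalerBr scalerA mulVf ?w_neq0 // scale1r.
have half (C : T i n.+3) : core_ideal (C + C) -> core_ideal C.
  move=> hC; have := core_idealZ 2^-1 hC.
  by rewrite -mulr2n -scaler_nat scalerA mulVf // scale1r.
have eA : A + A = A + B + (A - B) by rewrite addrACA subrr addr0.
have eB : B + B = A + B - (A - B) by rewrite opprB (addrC A) addrACA subrr addr0.
split; apply: half; first by rewrite eA; apply: core_idealD.
by rewrite eB; apply: core_idealB.
Qed.

Lemma addKB (V : zmodType) (x y z : V) : x + y - (x - z) = y + z.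
Proof. by rewrite opprB (addrC x) addrACA subrr addr0. Qed.

(** The toggling rule at a final zero, which has one neighbour only. *)
Lemma core_last i :
  core_ideal (eproj true (ebasis (i + 1) 1 [::]) + ebasis i 2 [::]).
Proof.
have -> : ebasis i 2 [::] = eproj false (ebasis (i + 1) 1 [::]) by [].
rewrite addrC -tens1E; apply: core_tens1.
by rewrite -[ebasis _ _ _]scale1r; apply: rel_ideal_ebasis1; rewrite rpred1.
Qed.

(** Toggling around a zero moves the 1 two places to the right with a change of sign; as the length
    is even, it reaches the penultimate place, where [core_last] removes it. *)
Lemma core_shift_one i k :
  core_ideal (ebasis i k.*2.+2 [:: true]
              - (-1) ^+ k.+1 *: ebasis i k.*2.+2 [::]).
Proof.
elim: k i => [|k IHk] i.
  by rewrite expr1 scaleN1r opprK; apply: core_last.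
pose e b := ebasis (i + 1 + 1) k.*2.+2 b.
have hi : core_ideal (eproj false (eproj false (e [:: true]))
                      + eproj true (eproj false (e [::]))).
  by have [_] := core_interior (ebasis (i + 1 + 1 + 1) k.*2.+1 [::]).
have -> : ebasis i k.+1.*2.+2 [:: true] = eproj true (eproj false (e [::])) by [].
have -> : ebasis i k.+1.*2.+2 [::] = eproj false (eproj false (e [::])) by [].
have := core_idealB hi (core_eproj false (core_eproj false (IHk (i + 1 + 1)))).
rewrite (eprojB false (e [:: true])) (eprojZ false _ (e [::])) eprojB eprojZ addKB.
by rewrite (exprS _ k.+1) mulN1r scaleNr opprK.
Qed.

(** The pair of zeros moves past one 1 at a time: 0 0 1 becomes 1 0 0 with a minus sign. *)
Lemma core_shift_ones i n r : (r <= n)%N ->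
  core_ideal (ebasis i n.+2 [:: false, false & nseq r true]
              - (-1) ^+ r *: ebasis i n.+2 (nseq r true)).
Proof.
elim: r n i => [|r IHr] n i hr.
  by rewrite expr0 scale1r subrr => y; rewrite scaler0; apply: rel_ideal0.
case: n hr => // n hr.
pose t := ebasis (i + 1 + 1 + 1) n (nseq r true).
have [_] := core_interior t; rewrite addrC => hi.
have -> : ebasis i n.+3 [:: false, false & nseq r.+1 true]
    = eproj false (eproj false (eproj true t)) by [].
have -> : ebasis i n.+3 (nseq r.+1 true)
    = eproj true (ebasis (i + 1) n.+2 (nseq r true)) by [].
have := core_idealB hi (core_eproj true (IHr n (i + 1) hr)).
rewrite eprojB eprojZ.
have -> : ebasis (i + 1) n.+2 [:: false, false & nseq r true]
    = eproj false (eproj false t) by [].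
have -> : gact tau (i + 1) true ((-1) ^+ r) = (-1) ^+ r :> F.
  by rewrite /= rmorphXn rmorphN1.
by rewrite addKB exprS mulN1r scaleNr opprK.
Qed.

(** [core_shift_one] makes both terms of [rel_ideal_first] multiples of e_(0,...,0). These are the
    multiples whose symbol vanishes. *)
Lemma rel_ideal_kernel i k b :
  rel_ideal ((b - (-1) ^+ k.+1 * tau i b) *: ebasis i k.*2.+1 [::]).
Proof.
case: k => [|k].
  apply: rel_ideal_ebasis1; apply: tau_fixed.
  by rewrite expr1 mulN1r opprK rmorphD tau_invol addrC.
have := rel_ideal_first b (ebasis (i + 1 + 1) k.*2.+1 [::]).
have -> : eproj false (eproj false (ebasis (i + 1 + 1) k.*2.+1 [::]))
    = ebasis i k.+1.*2.+1 [::] by [].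
have := core_eproj false (@core_shift_one (i + 1) k).
rewrite eprojB eprojZ.
have -> : eproj false (ebasis (i + 1) k.*2.+2 [::]) = ebasis i k.+1.*2.+1 [::] by [].
have -> : eproj true (ebasis (i + 1 + 1) k.*2.+1 [::])
    = ebasis (i + 1) k.*2.+2 [:: true] by [].
set u := eproj _ _; set e := ebasis _ _ _ => /(_ (tau i b)) h1 h2.
have := rel_idealB h2 h1.
congr rel_ideal; rewrite scalerBr (addrC (b *: _)) addKB /= scalerA -scalerDl.
by congr (_ *: _); rewrite (exprS _ k.+1); ring.
Qed.

(** * The normal form modulo the ideal *)

(** The number of ones runs over 1, 3, ..., n for odd [n] and over 2, 4, ..., n for even [n], where
    n = j - i - 1. *)
Definition span_elt i n a0 (a : nat -> F) : T i n := a0 *: ebasis i n [::]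
    + \sum_(k < n.+1./2) a k *: ebasis i n (nseq (k.*2.+1 + ~~ odd n)%N true).

Definition spanned i n (t : T i n) : Prop :=
  exists a0 a, rel_ideal (t - span_elt i n a0 a).

Lemma spanned_cong i n (t u : T i n) : rel_ideal (t - u) -> spanned u -> spanned t.
Proof.
move=> h [a0 [a ha]]; exists a0, a.
by have := rel_idealD h ha; rewrite addrA subrK.
Qed.

Lemma spannedB i n (t u : T i n) : spanned t -> spanned u -> spanned (t - u).
Proof.
move=> [a0 [a ha]] [b0 [b hb]]; exists (a0 - b0), (fun k => a k - b k).
have := rel_idealB ha hb; congr rel_ideal; rewrite /span_elt.
under [in RHS]eq_bigr do rewrite scalerBl.
rewrite scalerBl sumrB (addrACA (a0 *: _)) -opprD !opprB addrACA [RHS]addrACA.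
by congr (_ + _); apply: addrC.
Qed.

Lemma spanned_rel i n (t : T i n) : rel_ideal t -> spanned t.
Proof.
move=> ht; exists 0, (fun=> 0); rewrite /span_elt scale0r big1 ?addr0 ?subr0 // => k _.
by rewrite scale0r.
Qed.

Lemma spannedD i n (t u : T i n) : spanned t -> spanned u -> spanned (t + u).
Proof.
move=> ht hu; rewrite -[u]opprK; apply: spannedB => //; rewrite -sub0r.
by apply: spannedB => //; apply/spanned_rel/rel_ideal0.
Qed.

Lemma spanned_ebasis0 i n a : spanned (a *: ebasis i n [::]).
Proof.
exists a, (fun=> 0); rewrite /span_elt big1 ?addr0 ?subrr; first exact: rel_ideal0.
by move=> k _; rewrite scale0r.
Qed.

Lemma spanned_ebasis i n r a : (r <= n)%N -> odd r = odd n ->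
  spanned (a *: ebasis i n (nseq r true)).
Proof.
case: r => [|r] hr hp; first exact: spanned_ebasis0.
have hk : ((r - ~~ odd n)./2 < n.+1./2)%N by lia.
exists 0, (fun k => if k == (r - ~~ odd n)./2 then a else 0).
rewrite /span_elt (bigD1 (Ordinal hk)) //= eqxx big1 => [|k /negPf hkn]; last first.
  by move: hkn; rewrite -val_eqE /= => ->; rewrite scale0r.
have -> : ((r - ~~ odd n)./2.*2 + ~~ odd n)%N = r by move: hp => /=; lia.
by rewrite scale0r add0r addr0 subrr; apply: rel_ideal0.
Qed.

(** One more 1 keeps the parity right, except for r = 0 and [n] odd, where [core_shift_one] removes
    it. *)
Lemma spanned_eproj_true i n r a : (r <= n)%N -> r = 0%N \/ odd r = odd n ->
  spanned (a *: eproj true (ebasis (i + 1) n (nseq r true))).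
Proof.
move=> hr hp; have [pn|] := eqVneq (odd r) (odd n).
  rewrite -[eproj _ _]/(ebasis i n.+1 (nseq r.+1 true)).
  by apply: spanned_ebasis => //=; rewrite pn.
case: hp => [-> /= hn|-> /eqP //].
have nE : n = n./2.*2.+1 by lia.
rewrite nE; set k := n./2.
apply: (spanned_cong _ (spanned_ebasis0 i k.*2.+2 (a * (-1) ^+ k.+1))).
by rewrite -scalerA -scalerBr; apply: core_shift_one.
Qed.

(** A 0 in front of ones is absorbed in two moves: toggle the second entry, then move the two zeros
    past the remaining ones. *)
Lemma spanned_eproj_false i n r a : (r <= n)%N -> r = 0%N \/ odd r = odd n ->
  spanned (a *: eproj false (ebasis (i + 1) n (nseq r true))).
Proof.
case: r => [|r] hr hp; first exact: (spanned_ebasis0 i n.+1 a).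
case: hp => // hp; case: n hr hp => // n hr hp.
(* With the scalar tau_i(a), the second term of the relation has coefficient a. *)
have h1 := rel_ideal_first (tau i a) (ebasis (i + 1 + 1) n (nseq r true)).
rewrite tau_invol in h1.
have h2 := @core_shift_ones i n r hr (tau i a).
apply: (@spanned_cong _ _ _ (- tau i a * (-1) ^+ r *: ebasis i n.+2 (nseq r true))).
  have := rel_idealB h1 h2; congr rel_ideal.
  by rewrite scalerBr addKB mulNr scaleNr opprK scalerA.
by apply: spanned_ebasis; [lia|move: hp => /=; case: (odd r); case: (odd n)].
Qed.

Lemma spanned_tens1 i n x (t : T (i + 1) n) : spanned t -> spanned (x *: tens1 t).
Proof.
have single r b : (r <= n)%N -> r = 0%N \/ odd r = odd n ->
    spanned (x *: tens1 (b *: ebasis (i + 1) n (nseq r true))).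
  move=> hr hp; rewrite tens1E (eprojZ false) (eprojZ true) scalerDr !scalerA.
  apply: spannedD; first exact: spanned_eproj_false.
  exact: spanned_eproj_true.
move=> [a0 [a ha]]; have := rel_ideal_tens1 x ha.
rewrite tens1B scalerBr => h; apply: spanned_cong h _.
rewrite /span_elt tens1D scalerDr; apply: spannedD; first by apply: (single 0%N); [|left].
rewrite (big_morph (@tens1 i n) (@tens1D i n) (@tens1_0 i n)) scaler_sumr.
apply: big_ind; [exact/spanned_rel/rel_ideal0|exact: spannedD|].
by move=> k _; apply: single; [have := ltn_ord k; lia|right; lia].
Qed.

Lemma spanned_all i n (t : T i n) : spanned t.
Proof.
elim: n i t => [|n IHn] i; elim/tensor_ind.
- exact/spanned_rel/rel_ideal0.
- by move=> t u; apply: spannedB.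
- move=> [|x []] // _; rewrite -[x in pure _ _ _ [:: x]]mulr1 -(@scale_pure i 0 x) //.
  exact: (spanned_ebasis0 i 0 x).
- exact/spanned_rel/rel_ideal0.
- by move=> t u; apply: spannedB.
by move=> [|x s] // [hs]; rewrite pure_cons //; apply: spanned_tens1; apply: IHn.
Qed.

(** * Symbols of normal forms *)

Lemma symbolB i n (t u : T i n) b x : symbol (t - u) b x = symbol t b x - symbol u b x.
Proof.
rewrite /symbol -demazureB; apply: demazure_ext => y; exact: demazure_actB.
Qed.

Lemma symbolD i n (t u : T i n) b x : symbol (t + u) b x = symbol t b x + symbol u b x.
Proof. by apply: (additiveD (f := fun t => symbol t b x)) => {}t {}u; apply: symbolB. Qed.

Lemma symbol0 i n b x : symbol (0 : T i n) b x = 0.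
Proof. by rewrite -(subrr 0) symbolB subrr. Qed.

Lemma symbol_emb i (d : int) n (t : T i n) b x : d = n.+1 ->
  D i (comp_act (emb d t) (dirac b)) x = symbol t b x.
Proof. by move=> hd; apply: demazure_ext => y; apply: comp_act_emb. Qed.

Lemma symbol_rel i n (t : T i n) b x : rel_ideal t -> symbol t b x = 0.
Proof.
move=> ht; rewrite -(@symbol_emb i (i + n.+1%:Z - i)); last lia.
exact: ideal_act (ht _ erefl).
Qed.

Lemma symbol_span i n a0 a b k : (k < n.+1./2)%N -> b \in K (i + n.+1%:Z) ->
  symbol (span_elt i n a0 a) b (sg i * (k.*2.+1 + ~~ odd n)%N%:Z)
  = a k * esign i (k.*2.+1 + ~~ odd n)
    * sbar tau i (nseq (k.*2.+1 + ~~ odd n) true) b.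
Proof.
move=> hk bK; rewrite symbolD.
have -> : symbol (a0 *: ebasis i n [::]) b (sg i * (k.*2.+1 + ~~ odd n)%N%:Z) = 0.
  have [hn|hn] := boolP (odd n); first by rewrite symbol_ebasis0_odd //=; lia.
  rewrite (@symbol_ebasis i n 0) //; try by move: hn; lia.
  by have -> : ((k.*2.+1 + true)%N == 0%N) = false; [lia|rewrite mulr0].
rewrite add0r (big_morph (fun t : T i n => symbol t b _)
  (fun t u => symbolD t u b _) (symbol0 i n b _)).
rewrite (bigD1 (Ordinal hk)) // big1 => [|l /negPf hl].
  rewrite [LHS]addr0 -[nat_of_ord (Ordinal hk)]/k symbol_ebasis ?eqxx ?mulr1 //; lia.
rewrite symbol_ebasis //; last 1 first; try by have := ltn_ord l; lia.
have -> : ((k.*2.+1 + ~~ odd n)%N == (l.*2.+1 + ~~ odd n)%N) = false.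
  by move: hl; rewrite -val_eqE /=; lia.
by rewrite mulr0.
Qed.

Lemma symbol_span0 i n a0 a b : b \in K (i + n.+1%:Z) ->
  symbol (span_elt i n a0 a) b 0
  = (if odd n then a0 + c i * c (i + n.+1%:Z) * tau i a0 else a0) * b.
Proof.
move=> bK; rewrite symbolD.
have -> : symbol (\sum_(k < n.+1./2)
    a k *: ebasis i n (nseq (k.*2.+1 + ~~ odd n)%N true)) b 0 = 0.
  rewrite (big_morph (fun t : T i n => symbol t b _)
    (fun t u => symbolD t u b _) (symbol0 i n b _)); apply: big1 => k _.
  have := @symbol_ebasis i n (k.*2.+1 + ~~ odd n) (a k) b 0.
  by rewrite !mulr0 => -> //; have := ltn_ord k; lia.
rewrite addr0; have [hn|hn] := boolP (odd n); first by rewrite symbol_ebasis0.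
have := @symbol_ebasis i n 0 a0 b 0.
by rewrite mulr0 => -> //; [rewrite /= !mulr1|lia].
Qed.

Lemma symbol_cong i n (t u : T i n) b x : rel_ideal (t - u) -> symbol t b x = symbol u b x.
Proof. by move=> h; apply/eqP; rewrite -subr_eq0 -symbolB symbol_rel. Qed.

Lemma csign_double i k : c i * c (i + k.*2%:Z) = (-1) ^+ k.
Proof.
elim: k => [|k IHk]; first by rewrite addr0 csignM.
have -> : i + k.+1.*2%:Z = i + k.*2%:Z + 2 by lia.
by rewrite csign2 mulrN IHk exprS mulN1r.
Qed.

(** The symbol detects normal forms modulo the ideal. For odd [n] its vanishing makes [a0] an
    eigenvector of tau_i, as in [rel_ideal_kernel]. *)
Lemma rel_ideal_span i n a0 a : (forall k, (k < n.+1./2)%N -> a k = 0) ->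
  (if odd n then a0 + c i * c (i + n.+1%:Z) * tau i a0 else a0) = 0 ->
  rel_ideal (span_elt i n a0 a).
Proof.
move=> ha h0; rewrite /span_elt big1 => [|k _]; last by rewrite ha // scale0r.
rewrite addr0; move: h0; case: ifP => hn; last first.
  by move=> ->; rewrite scale0r; apply: rel_ideal0.
have nE : n = n./2.*2.+1 by lia.
rewrite nE -[(_.*2.+2)]/(n./2.+1).*2 csign_double; set k := n./2 => h0.
(* For b = a0 / 2 the eigenvector equation gives b - (-1)^(k+1) tau_i(b) = 2 b = a0. *)
have := @rel_ideal_kernel i k (2^-1 * a0); congr (rel_ideal (_ *: _)).
have -> : (-1) ^+ k.+1 * tau i (2^-1 * a0) = - (2^-1 * a0).
  have /eqP := h0; rewrite addrC addr_eq0 => /eqP e.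
  rewrite rmorphM fmorphV rmorph_nat mulrCA e mulrN //.
by field.
Qed.

(** * From symbols to bimodule isomorphisms *)

Definition csymbol i j (z : tensor_alg K0 K1 i j) b x := D i (comp_act z (dirac b)) x.

Lemma csymbolB i j (z z' : tensor_alg K0 K1 i j) b x :
  csymbol (z - z') b x = csymbol z b x - csymbol z' b x.
Proof. by rewrite /csymbol -demazureB; apply: demazure_ext => y; apply: comp_actB. Qed.

Lemma comp_act_scal i (d : int) (a : subfield (K i)) m x : d = 0 ->
  comp_act (comp_scal U d a) m x = sfval a * m x.
Proof. by move=> ->. Qed.

(** [a] commutes with the outer factor 1 + c_i tau_i, and [b] becomes the scalar on which the
    operators act. *)
Lemma csymbol_act i j (a : subfield (K i)) (z : tensor_alg K0 K1 i j) (b : subfield (K j)) x :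
  csymbol (zmul (zmul (upper_scal U a : tensor_alg K0 K1 i i) z)
                (upper_scal U b : tensor_alg K0 K1 j j)) 1 x
  = sfval a * csymbol z (sfval b) x.
Proof.
rewrite /csymbol -demazureZ ?sfvalP //; apply: demazure_ext => y.
rewrite [LHS]comp_actM; try lia.
rewrite comp_actM; try lia.
rewrite comp_act_scal; last lia.
congr (_ * _); apply: comp_act_ext => v; rewrite comp_act_scal; last lia.
by rewrite /dirac mul1r.
Qed.

(** The first isomorphism theorem for one component; the inverse comes from a choice of
    preimages. *)
Lemma quotient_iso i j (N : zmodType) (act : subfield (K i) -> N -> subfield (K j) -> N)
    (g : tensor_alg K0 K1 i j -> N) :
  {morph g : x y / x - y} -> (forall z, g z = 0 <-> R z) ->
  (forall y, exists z, g z = y) ->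
  (forall a z b, g (zmul (zmul (upper_scal U a : tensor_alg K0 K1 i i) z)
                         (upper_scal U b : tensor_alg K0 K1 j j)) = act a (g z) b) ->
  bimod_iso (@nc_sym_act F K0 K1 w i j) act.
Proof.
move=> gB g0 gsurj gact.
pose f (x : nc_sym K0 K1 w i j) : N := g (repr x).
have fpi z : f (zquot_pi (@nc_rel F K0 K1 w) z) = g z.
  apply/eqP; rewrite -subr_eq0 -gB; apply/eqP/g0.
  by have /asboolP := repr_pi (zideal (@nc_rel F K0 K1 w) (i:=i) (j:=j)) z.
have fB : zmod_morphism f.
  move=> x y; have [u ->] := zquot_piK x; have [v ->] := zquot_piK y.
  have -> : zquot_pi (@nc_rel F K0 K1 w) u - zquot_pi (@nc_rel F K0 K1 w) v
          = zquot_pi (@nc_rel F K0 K1 w) (u - v) by rewrite /zquot_pi piB.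
  by rewrite !fpi gB.
have finj : injective f.
  move=> x y /eqP; rewrite -subr_eq0 -fB => /eqP h; apply/eqP; rewrite -subr_eq0.
  move: h; have [u ->] := zquot_piK (x - y); rewrite fpi => /g0 hu.
  by apply/eqP/pi_eq0/asboolP.
have [h hK] := boolp.choice gsurj.
pose fa : {additive nc_sym K0 K1 w i j -> N} :=
  HB.pack f (GRing.isZmodMorphism.Build _ _ f fB).
exists fa; split.
  exists (fun y => zquot_pi (@nc_rel F K0 K1 w) (h y)) => [x|y] /=.
    by apply: finj; rewrite fpi hK.
  by rewrite fpi hK.
move=> a x b /=; have [u ->] := zquot_piK x.
by rewrite /nc_sym_act /= !zquot_mulE !fpi gact.
Qed.

Lemma comp_scal_surj i (d : int) (z : Defs.comp U i d) :
  d = 0 -> exists a, z = comp_scal U d a.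
Proof. by move=> hd; subst d; exists z. Qed.

Lemma comp_scal0 i (d : int) : comp_scal U d (0 : subfield (K i)) = 0.
Proof. by case: d => [[]|]. Qed.

Lemma csymbol_emb i j n (t : T i n) b x : j = i + n.+1%:Z ->
  csymbol (emb (j - i) t : tensor_alg K0 K1 i j) b x = symbol t b x.
Proof. by move=> hj; apply: symbol_emb; lia. Qed.

Lemma csymbol_diag i j (z : tensor_alg K0 K1 i j) (a : subfield (K i)) b :
  j = i -> z = comp_scal U (j - i) a -> csymbol z b 0 = sfval a * b.
Proof.
move=> hj ->; rewrite /csymbol /demazure !comp_act_scal; try lia.
have -> : dirac b (rho i 0) = 0.
  by rewrite /dirac /rho; case: (2 %| i)%Z; rewrite mulr0.
by rewrite mulr0 rmorph0 mulr0 addr0 /dirac mulr1.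
Qed.

Lemma emb_all i j n (z : tensor_alg K0 K1 i j) : j = i + n.+1%:Z ->
  exists2 t : T i n, z = emb (j - i) t & exists a0 a, rel_ideal (t - span_elt i n a0 a).
Proof.
move=> hj; have [|t ->] := @emb_surj i (j - i) n z; first by lia.
by exists t => //; apply: spanned_all.
Qed.

Lemma csymbol_rel i j (z : tensor_alg K0 K1 i j) b x : R z -> csymbol z b x = 0.
Proof. exact: ideal_act. Qed.

(** * Components with j - i odd *)

Section Odd.
Variables (i j : int) (m : nat).
Hypothesis hj : j = i + m.*2.+1%:Z.

(** The factor [esign] cancels the sign that the word tau_(i+1) ... tau_(i+2r+2) carries. *)
Definition odd_symbol (z : tensor_alg K0 K1 i j) : odd_sum F m :=
  (csymbol z 1 0,
   [ffun r : 'I_m => esign i r.+1.*2 * csymbol z 1 (sg i * r.+1.*2%:Z)]).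

Let idx (r : nat) : r.+1.*2 = (r.*2.+1 + ~~ odd m.*2)%N.
Proof. by rewrite odd_double addn1. Qed.

Let half_m : m.*2.+1./2 = m.
Proof. lia. Qed.

(** One normal form serves all right scalars [b]: b = 1 gives the coordinates, general [b] their
    right linearity. *)
Lemma odd_symbolP (z : tensor_alg K0 K1 i j) : exists a0 (a : nat -> F),
  (forall b, b \in K j -> csymbol z b 0 = a0 * b /\
     forall r, (r < m)%N -> csymbol z b (sg i * r.+1.*2%:Z)
       = a r * esign i r.+1.*2 * sbar tau i (nseq r.+1.*2 true) b) /\
  (a0 = 0 -> (forall r, (r < m)%N -> a r = 0) -> R z).
Proof.
have [t -> [a0 [a ha]]] := emb_all z hj; exists a0, a; split.
  move=> b bK; have bK' : b \in K (i + m.*2.+1%:Z) by rewrite -hj.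
  rewrite csymbol_emb // (symbol_cong _ _ ha) symbol_span0 // odd_double; split=> // r hr.
  rewrite csymbol_emb // (symbol_cong _ _ ha) idx symbol_span // half_m //.
move=> h0 hr; have h : rel_ideal (span_elt i m.*2 a0 a).
  by apply: rel_ideal_span; rewrite ?half_m // odd_double.
have := rel_idealD ha h; rewrite subrK; apply; exact: hj.
Qed.

Lemma odd_iso : bimod_iso (@nc_sym_act F K0 K1 w i j) (@odd_act F K0 K1 t0 t1 i j m).
Proof.
have one_in : 1 \in K j by rewrite rpred1.
apply: (quotient_iso (g := odd_symbol)) => [z z'|z|[y0 y]|a z b].
- rewrite /odd_symbol csymbolB; congr (_, _); apply/ffunP => r.
  by rewrite !ffunE csymbolB mulrBr.
- have [a0 [a [hs hR]]] := odd_symbolP z; have [e0 er] := hs 1 one_in; split.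
    case; rewrite e0 mulr1 => a00 /ffunP ha; apply: hR => // r hr.
    have := ha (Ordinal hr); rewrite !ffunE er //.
    by rewrite sbar1 mulr1 mulrC -mulrA esignM mulr1.
  move=> Rz; rewrite /odd_symbol csymbol_rel //; congr (_, _); apply/ffunP => r.
  by rewrite !ffunE csymbol_rel ?mulr0.
- pose a k := if insub k is Some r then y r else 0.
  exists (emb (j - i) (span_elt i m.*2 y0 a)); rewrite /odd_symbol csymbol_emb //.
  have one_in' : 1 \in K (i + m.*2.+1%:Z) by rewrite rpred1.
  rewrite symbol_span0 // odd_double mulr1; congr (_, _); apply/ffunP => r.
  rewrite ffunE csymbol_emb // idx symbol_span ?half_m // sbar1 mulr1.
  by rewrite mulrC -mulrA esignM mulr1 /a insubT // => hr; congr (y _); apply: val_inj.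
have [a0 [a' [hs hR]]] := odd_symbolP z; have [e0 er] := hs 1 one_in.
have [e0' er'] := hs _ (sfvalP b).
rewrite /odd_symbol /odd_act csymbol_act e0 e0' mulr1 mulrA; congr (_, _).
apply/ffunP => r; rewrite !ffunE csymbol_act er // er' // sbar1 mulr1.
rewrite /tau_bar /=; ring.
Qed.

End Odd.

(** * Components with j - i even *)

Section Even.
Variables (i j : int) (m : nat).
Hypothesis hj : j = i + m.*2%:Z.

(* The value at 0 of a symbol lies in the (-1)^m-eigenspace of tau_i, that is, in
   K_i or in w_i K_i. *)
Definition even_scale : F := if odd m then (w i)^-1 else 1.

Definition even_symbol (z : tensor_alg K0 K1 i j) : even_sum K0 K1 i m :=
  (to_sf (K i) (even_scale * csymbol z 1 0),
   [ffun r : 'I_m => esign i r.*2.+1 * csymbol z 1 (sg i * r.*2.+1%:Z)]).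

Lemma tau_even_scale : tau i even_scale = (-1) ^+ m * even_scale.
Proof.
rewrite /even_scale -signr_odd; case: (odd m); rewrite ?mul1r ?rmorph1 //.
by rewrite fmorphV tauw invrN mulN1r.
Qed.

Lemma even_scale_neq0 : even_scale != 0.
Proof. by rewrite /even_scale; case: ifP; rewrite ?oner_neq0 // invr_eq0 w_neq0. Qed.

Lemma K_target : K j = K i.
Proof. by rewrite hj /by_parity; have -> : (2 %| i + m.*2%:Z)%Z = (2 %| i)%Z by lia. Qed.

Lemma even_symbolP (z : tensor_alg K0 K1 i j) : exists a0 (a : nat -> F),
  [/\ even_scale * a0 \in K i,
     (forall b, b \in K j -> csymbol z b 0 = a0 * b /\
     forall r, (r < m)%N -> csymbol z b (sg i * r.*2.+1%:Z)
       = a r * esign i r.*2.+1 * sbar tau i (nseq r.*2.+1 true) b) &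
  (a0 = 0 -> (forall r, (r < m)%N -> a r = 0) -> R z)].
Proof.
have scale_in a : even_scale * (a + (-1) ^+ m * tau i a) \in K i.
  apply: tau_fixed; rewrite rmorphM rmorphD rmorphM tau_even_scale rmorphXn rmorphN1.
  rewrite tau_invol.
  have -> : (-1) ^+ m * even_scale * (tau i a + (-1) ^+ m * a)
    = even_scale * ((-1) ^+ m * (-1) ^+ m * a + (-1) ^+ m * tau i a) by ring.
  by rewrite -exprD addnn -muln2 exprM sqrr_sign mul1r.
(* For m = 0 the component is K_i, without tensor factors, and is treated directly. *)
case: (posnP m) => hm.
  have ji : j = i by lia.
  have [|a ha] := comp_scal_surj (z : Defs.comp U i (j - i)); first by lia.
  exists (sfval a), (fun=> 0); split.
  - by rewrite /even_scale hm mul1r sfvalP.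
  - move=> b bK; rewrite (csymbol_diag _ ji ha); split=> // r; rewrite hm //.
  move=> a0 _; have -> : z = 0; last exact: id_0.
  have a00 : a = 0 by apply: val_inj.
  by rewrite ha a00 comp_scal0.
have hn : i + (m.*2.-1).+1%:Z = j by lia.
have [t -> [a0 [a ha]]] := @emb_all i j m.*2.-1 z (esym hn).
have o : odd m.*2.-1 by lia.
have h2 : (m.*2.-1).+1./2 = m by lia.
have cE : c i * c (i + (m.*2.-1).+1%:Z) = (-1) ^+ m by rewrite hn hj csign_double.
(* The symbol at the identity, and not the coefficient [a0] of the normal form, which is determined
   only up to the kernel. *)
exists (a0 + (-1) ^+ m * tau i a0), a; split=> //.
  move=> b; rewrite -{1}hn => bK.
  rewrite csymbol_emb // (symbol_cong _ _ ha) symbol_span0 // o cE; split=> // r hr.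
  have := @symbol_span i m.*2.-1 a0 a b r; rewrite o addn0 => <- //; last by rewrite h2.
  by rewrite csymbol_emb // (symbol_cong _ _ ha).
move=> h0 hr; have h : rel_ideal (span_elt i m.*2.-1 a0 a).
  by apply: rel_ideal_span; rewrite ?h2 // o cE.
have := rel_idealD ha h; rewrite subrK; apply; exact: esym.
Qed.

Lemma even_iso : bimod_iso (@nc_sym_act F K0 K1 w i j) (@even_act F K0 K1 t0 t1 i j m).
Proof.
have one_in : 1 \in K j by rewrite rpred1.
have s0 := even_scale_neq0.
have sin (z : tensor_alg K0 K1 i j) : even_scale * csymbol z 1 0 \in K i.
  have [a0 [a [hin hs _]]] := even_symbolP z; have [-> _] := hs 1 one_in.
  by rewrite mulr1.
apply: (quotient_iso (g := even_symbol)) => [z z'|z|[y0 y]|a z b].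
- rewrite /even_symbol; congr (_, _).
    by apply: val_inj; rewrite /= !to_sfK // csymbolB mulrBr.
  by apply/ffunP => r; rewrite !ffunE csymbolB mulrBr.
- have [a0 [a [_ hs hR]]] := even_symbolP z; have [e0 er] := hs 1 one_in; split.
    case=> /(congr1 (@sfval _ _)); rewrite to_sfK // e0 mulr1 => a00 /ffunP ha.
    apply: hR => [|r hr]; first by move/eqP: a00; rewrite mulf_eq0 (negPf s0) => /eqP.
    have := ha (Ordinal hr); rewrite !ffunE er //.
    by rewrite sbar1 mulr1 mulrC -mulrA esignM mulr1.
  move=> Rz; rewrite /even_symbol csymbol_rel //; congr (_, _).
    by apply: val_inj; rewrite /= mulr0 to_sfK ?rpred0.
  by apply/ffunP => r; rewrite !ffunE csymbol_rel ?mulr0.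
- case: (posnP m) => hm.
    have ji : j = i by lia.
    exists (comp_scal U (j - i) y0); rewrite /even_symbol; congr (_, _).
      apply: val_inj; rewrite /= to_sfK // (csymbol_diag 1 ji erefl) mulr1.
      by rewrite /even_scale hm mul1r.
    by apply/ffunP => r; exfalso; have := ltn_ord r; lia.
  have hn : i + (m.*2.-1).+1%:Z = j by lia.
  have o : odd m.*2.-1 by lia.
  have h2 : (m.*2.-1).+1./2 = m by lia.
  have cE : c i * c (i + (m.*2.-1).+1%:Z) = (-1) ^+ m by rewrite hn hj csign_double.
  pose a k := if insub k is Some r then y r else 0.
  (* This element satisfies (-1)^m tau_i(a0) = a0, so the symbol at the identity is 2 a0; hence the
     factor 1/2. *)
  pose a0 := 2^-1 * even_scale^-1 * sfval y0.
  have one_in' : 1 \in K (i + (m.*2.-1).+1%:Z) by rewrite rpred1.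
  exists (emb (j - i) (span_elt i m.*2.-1 a0 a)); rewrite /even_symbol; congr (_, _).
    apply: val_inj; rewrite /= to_sfK // csymbol_emb // symbol_span0 // o cE mulr1.
    have ss : (-1) ^+ m * (-1) ^+ m = 1 :> F.
      by rewrite -exprD addnn -muln2 exprM sqrr_sign.
    rewrite /a0 !rmorphM !fmorphV rmorph_nat tau_even_scale (tauK (sfvalP y0)).
    rewrite invfM -signr_odd invr_sign signr_odd mulrA (mulrA _ (2^-1)).
    have -> : (-1) ^+ m * 2^-1 * ((-1) ^+ m / even_scale) * sfval y0
      = (-1) ^+ m * (-1) ^+ m * (2^-1 / even_scale * sfval y0) by ring.
    by rewrite ss; field; rewrite s0 two_neq0.
  apply/ffunP => r; rewrite ffunE csymbol_emb //.
  have := @symbol_span i m.*2.-1 a0 a 1 r; rewrite o addn0 => -> //; last by rewrite h2.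
  rewrite sbar1 mulr1 mulrC -mulrA esignM mulr1 /a insubT // => hr.
  by congr (y _); apply: val_inj.
have [a0 [a' [hin hs hR]]] := even_symbolP z; have [e0 er] := hs 1 one_in.
have [e0' er'] := hs _ (sfvalP b).
have bK : sfval b \in K i by rewrite -K_target sfvalP.
rewrite /even_symbol /even_act; congr (_, _).
  congr (to_sf _ _); rewrite /= to_sfK ?sin // csymbol_act e0 e0' mulr1; ring.
apply/ffunP => r; rewrite !ffunE csymbol_act er // er' // sbar1 mulr1.
rewrite /tau_bar /=; ring.
Qed.

End Even.

End Splitting.

Theorem theorem1p1 (F : fieldType) (K0 K1 : divringClosed F)
    (charF : 2%N \notin [pchar F])
    (index0 : degree2 K0) (index1 : degree2 K1)
    (simpleF : simple_bimodule K0 K1)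
    (t0 t1 : {rmorphism F -> F})
    (g0 : gal_generator K0 t0) (g1 : gal_generator K1 t1)
    (w : int -> F)
    (hw : forall i : int, w i \notin by_parity K0 K1 i /\
                          w i ^+ 2 \in by_parity K0 K1 i) :
  zalg_iso (tensor_alg K0 K1) (twisted_alg g0 g1) /\
  (forall (i j : int) (m : nat), j = i + m.*2%:Z ->
     bimod_iso (@nc_sym_act F K0 K1 w i j) (@even_act F K0 K1 t0 t1 i j m)) /\
  (forall (i j : int) (m : nat), j = i + m.*2.+1%:Z ->
     bimod_iso (@nc_sym_act F K0 K1 w i j) (@odd_act F K0 K1 t0 t1 i j m)).
Proof.
have two0 : (2 : F) != 0.
  by apply: contraNneq charF => h; rewrite inE /= h eqxx.
have wK i : w i \notin by_parity K0 K1 i by case: (hw i).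
have w2K i : w i ^+ 2 \in by_parity K0 K1 i by case: (hw i).
have tauK i x : x \in by_parity K0 K1 i -> by_parity t0 t1 i x = x.
  exact: by_parity_fix g0 g1 i x.
have deg i : degree2 (by_parity K0 K1 i) by rewrite /by_parity; case: ifP.
have tauw i : by_parity t0 t1 i (w i) = - w i.
  apply: (gal_generator_sqrt (deg i)) (wK i) (w2K i).
  by rewrite /by_parity; case: ifP.
have span i z := degree2_span (deg i) z (wK i).
split; last split.
- apply: (@upper_zalg_iso F _ (tensor_upper (by_parity K0 K1))
    (tw_upper (by_parity_fix g0 g1)) (fun i n => @twist_map F _ (by_parity t0 t1) i n)).
  + by move=> i n x y; apply: twist_mapB.
  + by move=> i n; apply: (twist_map_bij two0 tauK tauw wK w2K span).
  + by move=> i n a x; apply: twist_map_upl.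
  + by move=> i n a x; apply: twist_map_upr.
  + by move=> i j m n x y hj; apply: twist_map_upm.
- by move=> i j m hj; apply: (even_iso two0 tauK tauw wK w2K span hj).
by move=> i j m hj; apply: (odd_iso two0 tauK tauw wK w2K span hj).
Qed.
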